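(* Let $X$ be any diffeological space with base point $\ast\in X$. Then the diffeological loop space $\mathcal{L}(X)$, with the constant loop at $\ast$ as unit $e$, is a smooth h-unital $A_\infty$-space in the category of diffeological spaces.
   Context: **Diffeology.** $\mathbb{N}$ is the set of non-negative integers. Diffeological spaces have plots defined on open subsets of Euclidean spaces $\mathbb{R}^m$, $m\in\mathbb{N}$. Subsets carry the subspace diffeology, products the product diffeology, and $C^\infty(A,B)$ the functional diffeology. A subduction is a smooth surjection whose target carries the push-forward diffeology. For smooth maps $f,g:A\to B$, $f\simeq g$ means that they are smoothly homotopic, i.e. there is a smooth map $H:\mathbb{R}\times A\to B$ with $H(0,\cdot)=f$ and $H(1,\cdot)=g$. **Paths and loops.** Let $\pi_{set}:\mathbb{R}\to\mathbb{R}$, $\pi_{set}(t)=\max\{0,\min\{1,t\}\}$. $\mathcal{P}(X)=\{u\in C^\infty(\mathbb{R},X)\mid u\circ\pi_{set}=u\}$ and $\mathcal{L}(X)=\{u\in\mathcal{P}(X)\mid u(0)=u(1)=\ast\}$, as diffeological subspaces of $C^\infty(\mathbb{R},X)$. **Associahedra as smooth cubic complexes.** For $n\ge2$ let $K_n=\{(t_1,\dots,t_n)\in\mathbb{R}^n\mid t_1=0,\ 0\le t_k\le k-1-\sum_{i=1}^{k-1}t_i\ (1<k<n),\ t_n=n-1-\sum_{i=1}^{n-1}t_i\}$, and let $\mathbb{b}_n=(0,\tfrac12,\dots,\tfrac12,\tfrac n2)\in K_n$ (so $\mathbb b_2=(0,1)$ and $K_2=\{\mathbb b_2\}$). For $r,s\ge2$,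 $r+s=n+1$, $1\le k\le r$, the face operator $\partial_k:\mathbb{R}^r\times\mathbb{R}^s\to\mathbb{R}^n$ is the linear map $\partial_k((t_1,\dots,t_r),(u_1,\dots,u_s))=(t_1,\dots,t_{k-1},u_1,\dots,u_{s-1},u_s+t_k,t_{k+1},\dots,t_r)$ (for $k=1$ this reads $(u_1,\dots,u_{s-1},u_s+t_1,t_2,\dots,t_r)$); it maps $K_r\times K_s$ bijectively onto a face $L_k(r,s)$ of $K_n$. The boundary of $K_n$ is the union of these faces, and $K_n$ is the union of the cones $L_k(r,s)\ast\mathbb b_n$ (for $n\ge3$). The cubic complex $\mathbb{K}(n)$ is a finite set of cells $\sigma\subset K_n$, each nonempty cell equipped with a surjection $\pi_\sigma:\mathbb{R}^q\to\sigma$, $q=\dim\sigma$, defined inductively: - $\mathbb{K}(2)=\{\emptyset,\{\mathbb b_2\}\}$. - For $n\ge3$, $\mathbb{K}(n)$ consists of $\emptyset$, $\{\mathbb b_n\}$, all cells $\sigma=\partial_k(\rho\times\kappa)$ with $r+s=n+1$, $r,s\ge 2$, $1\le k\le r$ and nonempty $\rho\in\mathbb{K}(r)$, $\kappa\in\mathbb{K}(s)$, where $\pi_\sigma=\partial_k\circ(\pi_\rho\times\pi_\kappa)$, and all joins $\sigma\ast\mathbb b_n=\{(1-t)x+t\,\mathbb b_n\mid x\in\sigma,\ t\in[0,1]\}$ of such $\sigma$, where $\pi_{\sigma\ast\mathbb b_n}(x,t)=(1-\pi_{set}(t))\pi_\sigma(x)+\pi_{set}(t)\,\mathbb b_n$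 for $(x,t)\in\mathbb{R}^{\dim\sigma}\times\mathbb{R}$. Each cell $\sigma$ carries the diffeology for which $\pi_\sigma$ is a subduction (one-point cells are trivial). $|\mathbb{K}(n)|$ is $K_n$ as a set, with the diffeology of the colimit of the cells (the finest diffeology for which all inclusions of cells are smooth). **h-unital $A_\infty$-space.** A diffeological space $G$ with base point $e$ (the unit) is a smooth h-unital $A_\infty$-space if there is a series of smooth maps $\{M(n):|\mathbb{K}(n)|\times G^n\to G\}_{n\ge2}$ (an $A_\infty$-form) such that: (1) $M(n)(\partial_k(\rho,\kappa);g_1,\dots,g_n)=M(r)(\rho;g_1,\dots,g_{k-1},M(s)(\kappa;g_k,\dots,g_{k+s-1}),g_{k+s},\dots,g_n)$ for all $r,s\ge2$, $r+s=n+1$, $1\le k\le r$, $\rho\in|\mathbb{K}(r)|$, $\kappa\in|\mathbb{K}(s)|$, $g_i\in G$; (2') the maps $g\mapsto M(2)(\mathbb b_2;e,g)$ and $g\mapsto M(2)(\mathbb b_2;g,e)$ are each smoothly homotopic to the identity of $G$. *)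

(* Defs.v *)
From HB Require Import structures.
From mathcomp Require Import all_boot all_order all_algebra.
From mathcomp Require Import interval_inference.
From mathcomp Require Import boolp classical_sets functions reals topology.
From mathcomp Require Import normedtype landau derive.
From mathcomp Require Import zify ring lra.

Set Implicit Arguments.
Unset Strict Implicit.
Unset Printing Implicit Defensive.

Import Order.TTheory GRing.Theory Num.Theory.
Import numFieldNormedType.Exports.

Local Open Scope classical_set_scope.
Local Open Scope ring_scope.

Section Smooth.
Context {R : realType}.

(* [f] is total but only its values on [U] matter when [U] is open. *)
Fixpoint Ck (k : nat) (V W : normedModType R) (U : set V) (f : V -> W) : Prop :=
  match k with
  | 0 => forall x, U x -> {for x, continuous f}
  | k.+1 => (forall x, U x -> differentiable f x) /\
            (forall v, Ck k U ('D_v f))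
  end.

Definition smooth_on (V W : normedModType R) (U : set V) (f : V -> W) : Prop :=
  forall k, Ck k U f.

Lemma near_eq_differentiable (V W : normedModType R) (f g : V -> W) (x : V) :
  (\forall y \near x, f y = g y) -> differentiable f x -> differentiable g x.
Proof.
move=> fg df.
have fgx : f x = g x by exact: nbhs_singleton fg.
have H : g \o shift x = cst (g x) + 'd f x +o_ (0 : V) id.
  have /diff_locally/eqaddoP fo := df.
  apply/eqaddoP => e e0; have {}fo := fo e e0; move: fo => /= fo.
  have fg0 : \forall y \near (0 : V), f (y + x) = g (y + x).
    by move: fg; rewrite (near_shift 0) subr0.
  by apply: filterS2 fo fg0 => h /= + E; rewrite !fctE /= E fgx.
have dg : 'd g x = 'd f x :> (V -> W).
  by apply: diff_unique => //; exact: diff_continuous.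
apply/diff_locallyP; rewrite dg; split => //.
exact: diff_continuous.
Unshelve. all: by end_near. Qed.


Section Scale.
Context (V W : normedModType R).

Let scale_is_bilinear :
  bilinear_for (GRing.Scale.Law.clone _ _ *:%R _)
    (GRing.Scale.Law.clone _ _ *:%R _) (@GRing.scale R W).
Proof.
split=> [w|c] a x y /=; first by rewrite scalerDl scalerA.
by rewrite scalerDr !scalerA mulrC.
Qed.

Let scaleB : {bilinear R -> W -> W} := HB.pack (@GRing.scale R W)
  (bilinear_isBilinear.Build R R W W _ _ (@GRing.scale R W) scale_is_bilinear).

Lemma differentiable_scale (a : V -> R) (f : V -> W) x :
  differentiable a x -> differentiable f x ->
  differentiable (fun y => a y *: f y) x.
Proof.
move=> da df.
have cB : continuous (fun p : R * W => scaleB p.1 p.2) by exact: scale_continuous.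
exact: (differentiable_comp (differentiable_pair da df)
  (differentiable_bilin (a x, f x) cB)).
Qed.

Lemma derive_scale (a : V -> R) (f : V -> W) x v :
  differentiable a x -> differentiable f x ->
  'D_v (fun y => a y *: f y) x = a x *: 'D_v f x + 'D_v a x *: f x.
Proof.
move=> da df; rewrite (deriveE v (differentiable_scale da df)).
rewrite (deriveE v da) (deriveE v df).
have cB : continuous (fun p : R * W => scaleB p.1 p.2) by exact: scale_continuous.
have /(congr1 (@^~ v)) := diff_comp (differentiable_pair da df)
  (differentiable_bilin (a x, f x) cB).
by rewrite (diff_bilin (a x, f x) cB) (diff_pair da df).
Qed.

End Scale.

Section Ck_theory.
Context {V : normedModType R} (U : set V) (oU : open U).

Lemma Ck_continuous (W : normedModType R) k (f : V -> W) x :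
  Ck k U f -> U x -> {for x, continuous f}.
Proof.
by case: k => [|k] /=; [exact | move=> [df _] /df /differentiable_continuous].
Qed.

Lemma CkW (W : normedModType R) k (f : V -> W) : Ck k.+1 U f -> Ck k U f.
Proof.
elim: k f => [|k IH] f.
  by move=> [df _] x /df /differentiable_continuous.
by move=> [df Df]; split => // v; apply: IH; exact: Df.
Qed.

Lemma Ck_eq (W : normedModType R) k (f g : V -> W) :
  (forall x, U x -> f x = g x) -> Ck k U f -> Ck k U g.
Proof.
have nearU x : U x -> nbhs x U by move=> Ux; exact: open_nbhs_nbhs.
elim: k f g => [|k IH] f g fg /=.
  move=> cf x Ux; suff: g @ x --> g x by [].
  rewrite -(fg x Ux); apply: cvg_trans (cf x Ux); apply: near_eq_cvg.
  by apply: filterS (nearU _ Ux) => y /fg.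
move=> [df Df].
have fgn x : U x -> \forall y \near x, f y = g y.
  by move=> /nearU; apply: filterS => y /fg.
split=> [x Ux|v]; first exact: near_eq_differentiable (fgn x Ux) (df x Ux).
by apply: IH (Df v) => x Ux; apply: near_eq_derive; exact: fgn.
Qed.

Lemma Ck_cst (W : normedModType R) k (w : W) : Ck k U (cst w).
Proof.
elim: k w => [|k IH] w /=; first by move=> x _; exact: cst_continuous.
split=> [x _|v]; first exact: differentiable_cst.
by apply: Ck_eq (IH 0) => x _; rewrite derive_cst.
Qed.

Lemma CkD (W : normedModType R) k (f g : V -> W) :
  Ck k U f -> Ck k U g -> Ck k U (f + g).
Proof.
elim: k f g => [|k IH] f g /=.
  by move=> cf cg x Ux; apply: continuousD; [exact: cf | exact: cg].
move=> [df Df] [dg Dg]; split=> [x Ux|v].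
  by apply: differentiableD; [exact: df | exact: dg].
apply: Ck_eq (IH _ _ (Df v) (Dg v)) => x Ux /=.
by rewrite deriveD//; apply: diff_derivable; [exact: df | exact: dg].
Qed.

Lemma Ck_id k : Ck k U (id : V -> V).
Proof.
case: k => [|k] /=; first by move=> x _; exact: cvg_id.
split=> [x _|v]; first exact: ex_diff.
by apply: Ck_eq (Ck_cst k v) => x _; rewrite derive_id.
Qed.

Lemma Ck_sum (W : normedModType R) k n (f : 'I_n -> V -> W) :
  (forall i, Ck k U (f i)) -> Ck k U (fun x => \sum_(i < n) f i x).
Proof.
move=> Cf; rewrite (_ : (fun _ => _) = \sum_(i < n) f i); last first.
  by apply/funext => x; rewrite fct_sumE.
by elim/big_ind : _ => // [|? ?]; [exact: Ck_cst | exact: CkD].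
Qed.

Lemma Ck_linear (W Z : normedModType R) k (L : {linear W -> Z}) (f : V -> W) :
  continuous L -> Ck k U f -> Ck k U (L \o f).
Proof.
move=> cL; elim: k f => [|k IH] f /=.
  by move=> cf x Ux; apply: continuous_comp; [exact: cf | exact: cL].
move=> [df Df]; split=> [x Ux|v].
  by apply: differentiable_comp; [exact: df | exact: linear_differentiable].
apply: Ck_eq (IH _ (Df v)) => x Ux /=.
have dfx := df x Ux; have dL : differentiable L (f x) by exact: linear_differentiable.
have dLf : differentiable (L \o f) x by exact: differentiable_comp.
by rewrite (deriveE v dLf) (diff_comp dfx dL) /= (diff_lin _ cL) (deriveE v dfx).
Qed.

Lemma Ck_scale (W : normedModType R) k (a : V -> R) (f : V -> W) :
  Ck k U a -> Ck k U f -> Ck k U (fun x => a x *: f x).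
Proof.
elim: k a f => [|k IH] a f.
  by move=> ca cf x Ux; apply: continuousZ; [exact: ca | exact: cf].
move=> Ca Cf; have [da Da] := Ca; have [df Df] := Cf; split=> [x Ux|v].
  by apply: differentiable_scale; [exact: da | exact: df].
apply: Ck_eq (CkD (IH _ _ (CkW Ca) (Df v)) (IH _ _ (Da v) (CkW Cf))) => x Ux /=.
by rewrite derive_scale//; [exact: da | exact: df].
Qed.

End Ck_theory.

Section Coord.
Variables (n : nat) (i : 'I_n).

Let coord_fun (t : 'rV[R]_n) : R := t 0 i.

Let coord_is_linear : linear coord_fun.
Proof. by move=> a u v; rewrite /coord_fun !mxE. Qed.

Definition coordL : {linear 'rV[R]_n -> R} :=
  HB.pack coord_fun (GRing.isLinear.Build _ _ _ _ _ coord_is_linear).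

End Coord.

Lemma Ck_local (V W : normedModType R) k (U : set V) (f : V -> W) :
  (forall x, U x -> exists A, [/\ A x, A `<=` U & Ck k A f]) -> Ck k U f.
Proof.
elim: k f => [|k IH] f H /=.
  by move=> x /H[A [Ax _ cf]]; exact: cf.
split=> [x /H[A [Ax _ [df _]]]|v]; first exact: df.
by apply: IH => x /H[A [Ax AU [_ DA]]]; exists A; split=> //; exact: DA.
Qed.

Lemma Ck_sub (V W : normedModType R) k (U A : set V) (f : V -> W) :
  A `<=` U -> Ck k U f -> Ck k A f.
Proof.
move=> AU; elim: k f => [|k IH] f /=; first by move=> cf x /AU; exact: cf.
by move=> [df Df]; split=> [x /AU/df//|v]; exact: IH.
Qed.

Lemma Ck_comp (V W : normedModType R) n k (U : set V) (A : set 'rV[R]_n)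
    (f : V -> 'rV[R]_n) (g : 'rV[R]_n -> W) :
  open U -> open A -> (forall x, U x -> A (f x)) ->
  Ck k U f -> Ck k A g -> Ck k U (g \o f).
Proof.
move=> oU oA fUA; elim: k g => [|k IH] g.
  move=> cf cg x Ux; apply: continuous_comp; first exact: cf.
  by apply: cg; exact: fUA.
move=> Cf Cg; have [df Df] := Cf; have [dg Dg] := Cg; split=> [x Ux|v].
  by apply: differentiable_comp; [exact: df | apply: dg; exact: fUA].
apply: (Ck_eq oU (f := fun x =>
  \sum_(i < n) ('D_v f x) 0 i *: 'D_(delta_mx 0 i) g (f x))) => [x Ux|].
  have dfx := df _ Ux; have dgx := dg _ (fUA _ Ux).
  rewrite (deriveE v (differentiable_comp dfx dgx)) (diff_comp dfx dgx) /=.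
  rewrite -(deriveE v dfx) [X in _ = 'd g (f x) X](row_sum_delta ('D_v f x)).
  rewrite linear_sum; apply: eq_bigr => i _.
  by rewrite linearZ /= (deriveE _ dgx).
apply: Ck_sum => // i; apply: Ck_scale => //.
  exact: (Ck_linear oU (L := @coordL n i)) (@coord_continuous _ _ _ 0 i) (Df v).
exact: (IH ('D_(delta_mx 0 i) g) (CkW Cf) (Dg _)).
Qed.

Lemma smooth_on_local (V W : normedModType R) (U : set V) (f : V -> W) :
  (forall x, U x -> exists A, [/\ A x, A `<=` U & smooth_on A f]) ->
  smooth_on U f.
Proof.
by move=> H k; apply: Ck_local => x /H[A [Ax AU Af]]; exists A; split.
Qed.

Lemma smooth_on_sub (V W : normedModType R) (U A : set V) (f : V -> W) :
  A `<=` U -> smooth_on U f -> smooth_on A f.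
Proof. by move=> AU sf k; exact: Ck_sub AU (sf k). Qed.

Lemma smooth_on_eq (V W : normedModType R) (U : set V) (f g : V -> W) :
  open U -> (forall x, U x -> f x = g x) -> smooth_on U f -> smooth_on U g.
Proof. by move=> oU fg sf k; exact: Ck_eq fg (sf k). Qed.

Lemma smooth_on_comp (V W : normedModType R) n (U : set V) (A : set 'rV[R]_n)
    (f : V -> 'rV[R]_n) (g : 'rV[R]_n -> W) :
  open U -> open A -> (forall x, U x -> A (f x)) ->
  smooth_on U f -> smooth_on A g -> smooth_on U (g \o f).
Proof. by move=> oU oA fUA sf sg k; exact: Ck_comp (sf k) (sg k). Qed.

Lemma smooth_on_preimage_open (V W : normedModType R) (U : set V) (A : set W)
    (f : V -> W) :
  open U -> open A -> smooth_on U f -> open (U `&` f @^-1` A).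
Proof.
move=> oU oA sf; rewrite openE => x [Ux Afx]; apply: filterI; first exact: open_nbhs_nbhs.
by apply: (Ck_continuous (sf 0) Ux); exact: open_nbhs_nbhs.
Qed.

End Smooth.

(* Plots are total functions of which only the values on the domain matter.
   Since a map into a nonempty set extends to the whole of R^m, and the only
   parametrization of the empty set is the empty one, nothing is lost. *)
Record diffeology (R : realType) (T : Type) := Diffeology {
  plot : forall m, set 'rV[R]_m -> ('rV[R]_m -> T) -> Prop;
  plot_open : forall m (U : set 'rV[R]_m) p, plot U p -> open U;
  plot_eq : forall m (U : set 'rV[R]_m) (p q : 'rV[R]_m -> T),
    (forall x, U x -> p x = q x) -> plot U p -> plot U q;
  plot_cst : forall m (U : set 'rV[R]_m) (t : T), open U -> plot U (cst t);
  plot_local : forall m (U : set 'rV[R]_m) (p : 'rV[R]_m -> T), open U ->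
    (forall x, U x -> exists A, [/\ A x, A `<=` U & plot A p]) -> plot U p;
  plot_comp : forall m n (U : set 'rV[R]_m) (A : set 'rV[R]_n)
      (h : 'rV[R]_n -> 'rV[R]_m) (p : 'rV[R]_m -> T),
    open A -> smooth_on A h -> (forall x, A x -> U (h x)) ->
    plot U p -> plot A (p \o h)
}.

Record diffSpace (R : realType) := DiffSpace {
  carrier :> Type;
  diffeo : diffeology R carrier
}.

Notation isplot X := (plot (diffeo X)).

Definition smooth (R : realType) (X Y : diffSpace R) (f : X -> Y) : Prop :=
  forall m (U : set 'rV[R]_m) (p : 'rV[R]_m -> X),
    isplot X U p -> isplot Y U (f \o p).

#[local] Obligation Tactic := idtac.

Section Constructions.
Context {R : realType}.

Section Euclidean.
Variable W : normedModType R.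

Program Definition euclid_diffeology : diffeology R W :=
  {| plot m U p := open U /\ smooth_on U p |}.
Next Obligation. by move=> m U p []. Qed.
Next Obligation.
by move=> m U p q pq [oU sp]; split=> //; exact: smooth_on_eq sp.
Qed.
Next Obligation. by move=> m U t oU; split=> // k; exact: Ck_cst. Qed.
Next Obligation.
move=> m U p oU H; split=> //; apply: smooth_on_local => x /H[A [Ax AU [_ sp]]].
by exists A.
Qed.
Next Obligation.
by move=> m n U A h p oA sh hAU [oU sp]; split=> //; exact: smooth_on_comp sp.
Qed.

Definition euclid : diffSpace R := DiffSpace euclid_diffeology.

End Euclidean.

Section Subspace.
Variables (X : diffSpace R) (P : set X).

Program Definition sub_diffeology : diffeology R {x : X | P x} :=
  {| plot m U p := isplot X U (fun x => sval (p x)) |}.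
Next Obligation. by move=> m U p /plot_open. Qed.
Next Obligation. by move=> m U p q pq; apply: plot_eq => x /pq ->. Qed.
Next Obligation. by move=> m U t oU; exact: plot_cst. Qed.
Next Obligation. by move=> m U p oU H; exact: plot_local. Qed.
Next Obligation. by move=> m n U A h p oA sh hAU /(plot_comp oA sh hAU). Qed.

Definition subspace_of : diffSpace R := DiffSpace sub_diffeology.

End Subspace.

Section Product.
Variables X Y : diffSpace R.

Program Definition prod_diffeology : diffeology R (X * Y) :=
  {| plot m U p := isplot X U (fst \o p) /\ isplot Y U (snd \o p) |}.
Next Obligation. by move=> m U p [/plot_open]. Qed.
Next Obligation.
by move=> m U p q pq [p1 p2]; split;
  [apply: plot_eq p1|apply: plot_eq p2] => x Ux /=; rewrite pq.
Qed.
Next Obligation. by move=> m U t oU; split; exact: plot_cst. Qed.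
Next Obligation.
by move=> m U p oU H; split; apply: plot_local => // x /H[A [Ax AU []]];
  exists A.
Qed.
Next Obligation.
by move=> m n U A h p oA sh hAU [/(plot_comp oA sh hAU) ? /(plot_comp oA sh hAU)].
Qed.

Definition prod_space : diffSpace R := DiffSpace prod_diffeology.

End Product.

Section Power.
Variables (n : nat) (X : diffSpace R).

Program Definition power_diffeology : diffeology R ('I_n -> X) :=
  {| plot m U p := open U /\ forall i, isplot X U (fun x => p x i) |}.
Next Obligation. by move=> m U p []. Qed.
Next Obligation.
move=> m U p q pq [oU pp]; split=> // i.
by apply: plot_eq (pp i) => x Ux; rewrite pq.
Qed.
Next Obligation. by move=> m U t oU; split=> // i; exact: plot_cst. Qed.
Next Obligation.
move=> m U p oU H; split=> // i; apply: plot_local => // x /H[A [Ax AU [_ pA]]].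
by exists A.
Qed.
Next Obligation.
move=> m k U A h p oA sh hAU [_ pp]; split=> // i.
exact: plot_comp oA sh hAU (pp i).
Qed.

Definition power_space : diffSpace R := DiffSpace power_diffeology.

End Power.

Section Functional.
Variables X Y : diffSpace R.

(* [phi] is a plot iff (u, x) |-> phi u x is smooth on U * X: a plot of U * X
   is a pair of a smooth map [a] into U and a plot [p] of X. *)
Program Definition fun_diffeology : diffeology R {f : X -> Y | smooth f} :=
  {| plot m U phi := open U /\
       forall n (A : set 'rV[R]_n) (a : 'rV[R]_n -> 'rV[R]_m) (p : 'rV[R]_n -> X),
         smooth_on A a -> (forall w, A w -> U (a w)) -> isplot X A p ->
         isplot Y A (fun w => sval (phi (a w)) (p w)) |}.
Next Obligation. by move=> m U p []. Qed.
Next Obligation.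
move=> m U p q pq [oU pp]; split=> // n A a r sa aU pr.
by apply: plot_eq (pp n A a r sa aU pr) => x Ax; rewrite pq//; exact: aU.
Qed.
Next Obligation.
by move=> m U f oU; split=> // n A a p sa aU /(svalP f).
Qed.
Next Obligation.
move=> m U phi oU H; split=> // n A a p sa aU pp.
have oA := plot_open pp; apply: plot_local => // w Aw.
have [B [Baw BU [oB pB]]] := H _ (aU _ Aw).
have oC : open (A `&` a @^-1` B) by exact: smooth_on_preimage_open.
exists (A `&` a @^-1` B); split; [by []|exact: subIsetl|].
apply: pB; [|by move=> x []|].
- by apply: smooth_on_sub sa; exact: subIsetl.
- by apply: (plot_comp (h := id) oC _ _ pp) => [|x []//];
    move=> k; exact: Ck_id.
Qed.
Next Obligation.
move=> m n U A h phi oA sh hAU [oU pp]; split=> // k B a p sa aA pB.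
apply: pp => //; last by move=> w /aA /hAU.
exact: smooth_on_comp (plot_open pB) oA aA sa sh.
Qed.

Definition fun_space : diffSpace R := DiffSpace fun_diffeology.

End Functional.

(* The finest diffeology on T making every [f i] smooth; for a single
   surjection this is the push-forward diffeology. *)
Section Final.
Variables (I : Type) (X : I -> diffSpace R) (T : Type) (f : forall i, X i -> T).

Definition admissible (D : diffeology R T) : Prop :=
  forall i, @smooth R (X i) (DiffSpace D) (@f i).

Program Definition final_diffeology : diffeology R T :=
  {| plot m U p := open U /\ forall D, admissible D -> plot D U p |}.
Next Obligation. by move=> m U p []. Qed.
Next Obligation.
move=> m U p q pq [oU pp]; split=> // D aD.
exact: plot_eq pq (pp D aD).
Qed.
Next Obligation. by move=> m U t oU; split=> // D _; exact: plot_cst. Qed.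
Next Obligation.
move=> m U p oU H; split=> // D aD; apply: plot_local => // x /H[A [Ax AU [_ pA]]].
by exists A; split=> //; exact: pA.
Qed.
Next Obligation.
move=> m n U A h p oA sh hAU [_ pp]; split=> // D aD.
exact: plot_comp oA sh hAU (pp D aD).
Qed.

End Final.

Definition ev (X Y : diffSpace R) (u : fun_space X Y) : X -> Y := sval u.

Definition homotopic (X Y : diffSpace R) (f g : X -> Y) : Prop :=
  exists H : prod_space (euclid R) X -> Y,
    [/\ smooth H, forall x, H (0, x) = f x & forall x, H (1, x) = g x].

Definition pi_set (t : R) : R := Num.max 0 (Num.min 1 t).

Definition paths (X : diffSpace R) : set (fun_space (euclid R) X) :=
  [set u : fun_space (euclid R) X | ev u \o pi_set = ev u].

Definition loops (X : diffSpace R) (x0 : X) : set (fun_space (euclid R) X) :=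
  [set u : fun_space (euclid R) X | [/\ paths u, ev u 0 = x0 & ev u 1 = x0]].

Definition loop_space (X : diffSpace R) (x0 : X) : diffSpace R :=
  subspace_of (loops x0).

Lemma smooth_cst (X Y : diffSpace R) (y : Y) : smooth (fun _ : X => y).
Proof. by move=> m U p /plot_open oU; exact: plot_cst. Qed.

Definition cst_map (X Y : diffSpace R) (y : Y) : fun_space X Y :=
  exist _ (fun=> y) (smooth_cst y).

Lemma cst_map_loop (X : diffSpace R) (x0 : X) : loops x0 (cst_map (euclid R) x0).
Proof. by []. Qed.

Definition cst_loop (X : diffSpace R) (x0 : X) : loop_space x0 :=
  exist _ (cst_map (euclid R) x0) (cst_map_loop x0).

End Constructions.

(* Indices of coordinates and faces start from 0, so that the k-th coordinate
   below is t_(k+1) and [face_op k] is the face operator \partial_(k+1). *)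
Section Associahedra.
Context {R : realType}.

Definition coord n (t : 'rV[R]_n) (i : nat) : R := oapp (t 0) 0 (insub i).

Definition associahedron n : set 'rV[R]_n :=
  [set t | [/\ coord t 0 = 0,
    forall k, (0 < k < n.-1)%N ->
      0 <= coord t k <= k%:R - \sum_(0 <= i < k) coord t i &
    coord t n.-1 = n.-1%:R - \sum_(0 <= i < n.-1) coord t i]].

Definition bary n : 'rV[R]_n :=
  \row_(i < n) (if i == 0 :> nat then 0
                else if i == n.-1 :> nat then n%:R / 2 else 1 / 2).

Definition face_op r s (k n : nat) (t : 'rV[R]_r) (u : 'rV[R]_s) : 'rV[R]_n :=
  \row_(i < n) (if (i < k)%N then coord t i
                else if (i < k + s.-1)%N then coord u (i - k)
                else if i == (k + s.-1)%N :> nat then coord u s.-1 + coord t k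
                else coord t (i - s.-1)).

Definition is_face (n r s k : nat) : bool :=
  [&& (1 < r)%N, (1 < s)%N, (r + s == n.+1)%N & (k < r)%N].

Lemma coordE n (t : 'rV[R]_n) (i : 'I_n) : coord t i = t 0 i.
Proof. by rewrite /coord valK. Qed.

Lemma coord_row n (f : nat -> R) i : (i < n)%N ->
  coord (\row_(j < n) f j) i = f i.
Proof. by move=> lt_in; rewrite (coordE _ (Ordinal lt_in)) mxE. Qed.

Lemma coordD n (t u : 'rV[R]_n) i : coord (t + u) i = coord t i + coord u i.
Proof. by rewrite /coord; case: insubP => [j _ _|_] /=; rewrite ?mxE ?addr0. Qed.

Lemma coordZ n a (t : 'rV[R]_n) i : coord (a *: t) i = a * coord t i.
Proof. by rewrite /coord; case: insubP => [j _ _|_] /=; rewrite ?mxE ?mulr0. Qed.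

Lemma associahedron_convex n (t u : 'rV[R]_n) (a : R) : 0 <= a <= 1 ->
  associahedron t -> associahedron u ->
  associahedron ((1 - a) *: t + a *: u).
Proof.
move=> /andP[a0 a1] [t0 tk tn] [u0 uk un].
have cE i : coord ((1 - a) *: t + a *: u) i = (1 - a) * coord t i + a * coord u i.
  by rewrite coordD !coordZ.
have sE k : \sum_(0 <= i < k) coord ((1 - a) *: t + a *: u) i =
    (1 - a) * (\sum_(0 <= i < k) coord t i) + a * \sum_(0 <= i < k) coord u i.
  by rewrite !mulr_sumr -big_split /=; apply: eq_bigr => i _.
split=> [|k kn|]; rewrite ?cE ?sE.
- by rewrite t0 u0 !mulr0 addr0.
- have /andP[t1 t2] := tk k kn; have /andP[u1 u2] := uk k kn.
  by apply/andP; split; nra.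
- by rewrite tn un; ring.
Qed.

Lemma associahedron_bary n : (1 < n)%N -> associahedron (bary n).
Proof.
move=> n1.
have cE i : (i < n)%N -> coord (bary n) i =
    if i == 0%N then 0 else if i == n.-1 then n%:R / 2 else 1 / 2.
  move=> lt_in; exact: (coord_row (fun i => if i == 0%N then 0
    else if i == n.-1 then n%:R / 2 else 1 / 2) lt_in).
have sE k : (k < n.-1)%N -> \sum_(0 <= i < k.+1) coord (bary n) i = k%:R / 2.
  elim: k => [|k IH] kn.
    by rewrite big_nat1 cE ?mul0r//; lia.
  rewrite big_nat_recr //= IH; last lia.
  rewrite cE; last lia.
  by rewrite /= ifF; [rewrite -(natr1 k); lra | lia].
split=> [|[//|k] kn|].
- by rewrite cE //; lia.
- rewrite sE; last lia.
  rewrite cE /=; last lia.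
  rewrite ifF; last lia.
  have : (0 : R) <= k%:R by [].
  by rewrite -(natr1 k) => k0; apply/andP; split; lra.
- case: n n1 cE sE => [|[|n]] // _ cE sE /=.
  rewrite sE // cE //= eqxx.
  by rewrite -!(natr1 n.+1) -(natr1 n); lra.
Qed.

Lemma associahedron_sum n (t : 'rV[R]_n) : (1 < n)%N -> associahedron t ->
  [/\ \sum_(0 <= i < n) coord t i = n.-1%:R,
      forall m, (0 < m <= n)%N -> \sum_(0 <= i < m) coord t i <= m.-1%:R &
      forall m, (m < n)%N -> 0 <= coord t m].
Proof.
move=> n1 [t0 tk tn].
pose T m := \sum_(0 <= i < m) coord t i.
have TS m : T m.+1 = T m + coord t m by rewrite /T big_nat_recr.
have Tn : T n = n.-1%:R.
  by rewrite -[in LHS](prednK (ltnW n1)) TS tn -/(T n.-1) addrCA subrr addr0.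
have Tle m : (0 < m <= n)%N -> T m <= m.-1%:R.
  case: m => [|[|m]] // mn; first by rewrite /T big_nat1 t0.
  have [<-|ne] := eqVneq n m.+2; first by rewrite Tn.
  have /tk/andP[_] : (0 < m.+1 < n.-1)%N by lia.
  by rewrite TS -/(T m.+1) /=; lra.
split=> // m mn; have [->|m0] := posnP m; first by rewrite t0.
have [->|ne] := eqVneq m n.-1; last first.
  by have /tk/andP[] : (0 < m < n.-1)%N by lia.
rewrite tn -/(T n.-1) subr_ge0; apply: (le_trans (Tle _ _)); first lia.
by rewrite ler_nat leq_pred.
Qed.

Lemma associahedron_face n r s k (t : 'rV[R]_r) (u : 'rV[R]_s) :
  is_face n r s k -> associahedron t -> associahedron u ->
  associahedron (face_op k n t u).
Proof.
case/and4P => r1 s1 /eqP rsn kr [t0 tk tn] [u0 uk un].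
pose F i := if (i < k)%N then coord t i
            else if (i < k + s.-1)%N then coord u (i - k)
            else if i == (k + s.-1)%N then coord u s.-1 + coord t k
            else coord t (i - s.-1).
have cE i : (i < n)%N -> coord (face_op k n t u) i = F i.
  by move=> lt_in; exact: (coord_row F lt_in).
have sumE m : (m <= n)%N -> \sum_(0 <= i < m) coord (face_op k n t u) i =
    \sum_(0 <= i < m) F i.
  by move=> mn; apply: eq_big_nat => i /andP[_ im]; apply: cE; lia.
pose T m := \sum_(0 <= i < m) coord t i.
pose U m := \sum_(0 <= i < m) coord u i.
have TS m : T m.+1 = T m + coord t m by rewrite /T big_nat_recr.
have US m : U m.+1 = U m + coord u m by rewrite /U big_nat_recr.
have S1 m : (m <= k)%N -> \sum_(0 <= i < m) F i = T m.
  by move=> mk; apply: eq_big_nat => i /andP[_ im]; rewrite /F ifT//; lia.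
have S2 m : (m <= s.-1)%N -> \sum_(0 <= i < k + m) F i = T k + U m.
  elim: m => [|m IH] ms; first by rewrite addn0 S1// /U big_nil addr0.
  rewrite addnS big_nat_recr //= IH; last lia.
  rewrite US addrA /F ifF; last lia.
  by rewrite ifT; [rewrite addKn|lia].
have [Tr Tle tge] := associahedron_sum r1 (And3 t0 tk tn).
have [Us Ule uge] := associahedron_sum s1 (And3 u0 uk un).
rewrite -/(T r) in Tr; rewrite -/(U s) in Us.
have Us' : U s.-1 + coord u s.-1 = s.-1%:R by rewrite -US prednK//; lia.
have S3 m : (0 < m)%N -> \sum_(0 <= i < k + s.-1 + m) F i = T (k + m)%N + s.-1%:R.
  case: m => // m _; elim: m => [|m IH].
    rewrite !addn1 big_nat_recr //= S2// /F ifF; last lia.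
    rewrite ifF; last lia.
    by rewrite eqxx TS -Us'; ring.
  rewrite (addnS (k + s.-1)) big_nat_recr //= IH /F ifF; last lia.
  rewrite ifF; last lia.
  rewrite ifF; last lia.
  rewrite (addnS k m.+1) (TS (k + m.+1)%N); have -> : (k + s.-1 + m.+1 - s.-1 = k + m.+1)%N by lia.
  by ring.
split=> [|m mn|].
- rewrite cE /F; last lia.
  have [k0|k0] := posnP k; last by rewrite t0.
  by rewrite k0 ifT; [rewrite u0|lia].
- rewrite cE; last lia.
  rewrite sumE; last lia.
  have Fge : 0 <= F m.
    rewrite /F; case: ltnP => [mk|km]; first by apply: tge; lia.
    case: ltnP => [ms|sm]; first by apply: uge; lia.
    case: eqP => [_|ne]; last by apply: tge; lia.
    by apply: addr_ge0; [apply: uge|apply: tge]; lia.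
  suff : \sum_(0 <= i < m.+1) F i <= m%:R.
    by rewrite big_nat_recr //= => Sle; apply/andP; split=> //; lra.
  have [mk|km] := ltnP m k; first by rewrite S1//; apply: Tle; lia.
  have [ms|sm] := ltnP m (k + s.-1).
    have -> : m.+1 = (k + (m - k).+1)%N by lia.
    rewrite S2; last lia.
    rewrite -[in leRHS](subnKC km) natrD; apply: lerD; last by apply: Ule; lia.
    have [->|k0] := posnP k; first by rewrite /T big_nil.
    by apply: (le_trans (Tle _ _)); [lia|rewrite ler_nat leq_pred].
  have -> : m.+1 = (k + s.-1 + (m - (k + s.-1)).+1)%N by lia.
  rewrite S3//; have em : m = (m - s.-1 + s.-1)%N by lia.
  rewrite [in leRHS]em natrD lerD2r.
  have -> : (k + (m - (k + s.-1)).+1 = (m - s.-1).+1)%N by lia.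
  by apply: Tle; lia.
- have n0 : (0 < n)%N by lia.
  have en : n = (k + s.-1 + (r - k))%N by lia.
  have : \sum_(0 <= i < n) coord (face_op k n t u) i = n.-1%:R.
    rewrite sumE// [in LHS]en S3; last lia.
    rewrite subnKC; last lia.
    by rewrite Tr -natrD; congr (_%:R); lia.
  by rewrite -[X in \sum_(0 <= i < X) _](prednK n0) big_nat_recr //= => <-; ring.
Qed.

End Associahedra.

(* The nonempty cells of the cubic complex, coded by their construction
   ([join_cell] is the join of the corresponding [face_cell] with the
   barycenter). Codes of the same subset have projections that differ by a
   permutation of the coordinates, hence define the same diffeology. The empty
   cell contributes nothing to the colimit. *)
Inductive cell : nat -> Type :=
| vertex2 : cell 2
| face_cell n r s k : is_face n r s k -> cell r -> cell s -> cell n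
| join_cell n r s k : is_face n r s k -> cell r -> cell s -> cell n.

Section CubicComplex.
Context {R : realType}.

Fixpoint cell_dim n (c : cell n) : nat :=
  match c with
  | vertex2 => 0
  | face_cell _ _ _ _ _ a b => cell_dim a + cell_dim b
  | join_cell _ _ _ _ _ a b => cell_dim a + cell_dim b + 1
  end.

Definition face_set n r s k (A : set 'rV[R]_r) (B : set 'rV[R]_s) :
    set 'rV[R]_n :=
  [set face_op k n t u | t in A & u in B].

Definition cone n (A : set 'rV[R]_n) (b : 'rV[R]_n) : set 'rV[R]_n :=
  [set (1 - a) *: x + a *: b | x in A & a in `[0, 1]].

Fixpoint cell_set n (c : cell n) : set 'rV[R]_n :=
  match c with
  | vertex2 => [set bary 2]
  | face_cell n _ _ k _ a b => face_set k (cell_set a) (cell_set b)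
  | join_cell n _ _ k _ a b =>
      cone (face_set k (cell_set a) (cell_set b)) (bary n)
  end.

Fixpoint cell_proj n (c : cell n) : 'rV[R]_(cell_dim c) -> 'rV[R]_n :=
  match c in cell n return 'rV[R]_(cell_dim c) -> 'rV[R]_n with
  | vertex2 => fun=> bary 2
  | face_cell n _ _ k _ a b => fun x =>
      face_op k n (cell_proj (lsubmx x)) (cell_proj (rsubmx x))
  | join_cell n _ _ k _ a b => fun xt =>
      let x := lsubmx xt in let t := pi_set (rsubmx xt 0 0) in
      (1 - t) *: face_op k n (cell_proj (lsubmx x)) (cell_proj (rsubmx x))
      + t *: bary n
  end.

Lemma pi_set_itv (t : R) : pi_set t \in `[0, 1].
Proof.
by rewrite in_itv /= /pi_set le_max lexx /= ge_max ler01 ge_min lexx.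
Qed.

Lemma cell_projP n (c : cell n) x : cell_set c (cell_proj (c := c) x).
Proof.
elim: c x => {n} [//|n r s k h a IHa b IHb x|n r s k h a IHa b IHb x] /=.
  by exists (cell_proj (lsubmx x)) => //; exists (cell_proj (rsubmx x)).
set y := face_op _ _ _ _.
exists y; first by exists (cell_proj (lsubmx (lsubmx x))) => //;
  exists (cell_proj (rsubmx (lsubmx x))).
by exists (pi_set (rsubmx x 0 0)) => //; exact: pi_set_itv.
Qed.

Lemma pi_set_id (t : R) : t \in `[0, 1] -> pi_set t = t.
Proof.
by rewrite in_itv /= => /andP[t0 t1]; rewrite /pi_set (min_r t1) (max_r t0).
Qed.

Lemma cell_proj_surj n (c : cell n) y :
  cell_set c y -> exists x, cell_proj (c := c) x = y.
Proof.
elim: c y => {n} [_ ->|n r s k h a IHa b IHb _ [t at_ [u bu <-]]|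
  n r s k h a IHa b IHb _ [_ [t at_ [u bu <-]] [z z01 <-]]] /=.
- by exists 0.
- have [x <-] := IHa _ at_; have [x' <-] := IHb _ bu.
  by exists (row_mx x x'); rewrite row_mxKl row_mxKr.
- have [x <-] := IHa _ at_; have [x' <-] := IHb _ bu.
  exists (row_mx (row_mx x x') (const_mx z)).
  by rewrite !(row_mxKl, row_mxKr) mxE pi_set_id.
Qed.

Lemma cell_set_sub n (c : cell n) : cell_set c `<=` @associahedron R n.
Proof.
elim: c => {n} [_ ->|n r s k h a IHa b IHb _ [t at_ [u bu <-]]|
  n r s k h a IHa b IHb _ [_ [t at_ [u bu <-]] [z z01 <-]]].
- exact: associahedron_bary.
- by apply: associahedron_face => //; [exact: IHa|exact: IHb].
- apply: associahedron_convex => //.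
    by apply: associahedron_face => //; [exact: IHa|exact: IHb].
  by apply: associahedron_bary; move: h; rewrite /is_face; lia.
Qed.

(* The diffeology for which [cell_proj] is a subduction. *)
Definition cell_space n (c : cell n) : diffSpace R :=
  DiffSpace (final_diffeology (I := unit) (X := fun=> euclid 'rV[R]_(cell_dim c))
    (fun _ x => exist (cell_set c) (cell_proj x) (cell_projP x))).

Definition complex_space n : diffSpace R :=
  DiffSpace (final_diffeology (X := @cell_space n)
    (fun c x => exist (@associahedron R n) (sval x) (cell_set_sub (svalP x)))).

Definition bary2 : complex_space 2 :=
  exist _ (bary 2) (associahedron_bary (n := 2) isT).

Definition face n r s k (h : is_face n r s k)
    (rho : complex_space r) (kappa : complex_space s) : complex_space n :=
  exist _ (face_op k n (sval rho) (sval kappa))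
    (associahedron_face h (svalP rho) (svalP kappa)).

End CubicComplex.

Section AinftySpaces.
Context {R : realType}.
Variable G : diffSpace R.

(* (g_0, ..., g_(k-1), x, g_(k+s), g_(k+s+1), ...) *)
Definition graft (k s : nat) (x : G) (g : nat -> G) (i : nat) : G :=
  if (i < k)%N then g i else if i == k then x else g (i + s.-1)%N.

(* Tuples are taken as initial segments of sequences, which loses nothing when
   G is nonempty; likewise only the [M n] with 1 < n are constrained. *)
Definition Ainfty_form
    (M : forall n, prod_space (complex_space n) (power_space n G) -> G) : Prop :=
  (forall n, (1 < n)%N -> smooth (M n)) /\
  (forall n r s k (h : is_face n r s k)
      (rho : complex_space r) (kappa : complex_space s) (g : nat -> G),
    M n (face h rho kappa, fun i : 'I_n => g i) =
    M r (rho, fun i : 'I_r =>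
           graft k s (M s (kappa, fun j : 'I_s => g (k + j)%N)) g i)).

Definition pair_tuple (x y : G) : power_space 2 G :=
  fun i : 'I_2 => if i == 0 :> nat then x else y.

Definition h_unital_Ainfty_space (e : G) : Prop :=
  exists M : forall n, prod_space (complex_space n) (power_space n G) -> G,
    [/\ Ainfty_form M,
        homotopic (fun g => M 2 (bary2, pair_tuple e g)) id &
        homotopic (fun g => M 2 (bary2, pair_tuple g e)) id].

End AinftySpaces.

(* Main.v *)
Require Import Defs.
From HB Require Import structures.
From mathcomp Require Import all_boot all_order all_algebra.
From mathcomp Require Import interval_inference.
From mathcomp Require Import boolp classical_sets functions reals topology.
From mathcomp Require Import normedtype derive sequences realfun exp.
From mathcomp Require Import zify ring lra.
(* [coord] must denote the coordinates of a point of an associahedron, not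
   those of a vector in a basis. *)
Import Defs.

(** The n-fold multiplication juxtaposes n loops along little intervals. A point
    of K_n determines n successive subintervals of [0, 1], of positive length
    and separated by gaps; the i-th loop runs on the i-th interval after an
    affine rescaling, and the product rests at the base point everywhere else.
    The gaps are what makes this work in an arbitrary diffeological space,
    where two plots cannot be glued at a point: near any parameter at most one
    factor is active, and that factor rests once its interval is left, so the
    product agrees there with a single reparametrized loop ([plot_juxt]).

    Juxtaposing juxtapositions amounts to substituting configurations of
    intervals into each other ([juxt_plug]). It remains to find configurations
    [cfg] on all the K_n that turn the face operators into substitutions
    ([cfg_insert]) and depend smoothly on the parameters of each cell
    ([smooth_cfg_cell]). By induction on n they are prescribed on the faces. On
    the segment from a boundary point x to the barycenter they interpolate
    between the configuration at x and a standard one ([cfg_cone]); convex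
    combinations keep the gaps. The interpolation parameter goes through a
    smooth step that is constant outside of [0, 1]. As this step does not see
    the retraction [pi_set] ([step_pi_set]), the configuration is a smooth
    function of the parameters of a cell although its projection is not. The
    position of a point on its segment is the minimum of the affine functions
    that define K_n, each divided by its value at the barycenter ([gauge]).

    Several faces may contain the same point, and then they have to prescribe
    the same configuration. A point t of K_n is coded by the path
    F m = t_1 + ... + t_m - m. It starts at 0, its steps are at least -1, and it
    stays at or below -1 until it ends at -1: a continuous analogue of the
    Lukasiewicz path of a tree. The faces through t correspond to the windows of
    F, called brackets, that look like shorter paths of the same kind, as the
    subtrees of a tree do. Two brackets never cross ([bracket_no_cross]). When
    they are nested or disjoint, each survives on the face given by the other,
    and associativity of substitution identifies the two prescriptions
    ([split_cfg_confluence]).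

    A product of two loops one of which is constant is the other one run on a
    subinterval. Widening that subinterval to [0, 1] is a homotopy to the
    identity ([homotopic_unit]). *)

Set Implicit Arguments.
Unset Strict Implicit.
Unset Printing Implicit Defensive.

Import Order.TTheory GRing.Theory Num.Theory.
Import numFieldNormedType.Exports.

Local Open Scope classical_set_scope.
Local Open Scope ring_scope.

(** * Smooth real functions and a smooth step *)

Section SmoothReal.
Context {R : realType}.

Lemma Ck_comp_real (V W : normedModType R) k (U : set V) (A : set R)
    (f : V -> R) (g : R -> W) :
  open U -> open A -> (forall x, U x -> A (f x)) ->
  Ck k U f -> Ck k A g -> Ck k U (g \o f).
Proof.
move=> oU oA fUA; elim: k g => [|k IH] g.
  move=> cf cg x Ux; apply: continuous_comp; first exact: cf.
  by apply: cg; exact: fUA.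
move=> Cf Cg; have [df Df] := Cf; have [dg Dg] := Cg; split=> [x Ux|v].
  by apply: differentiable_comp; [exact: df | apply: dg; exact: fUA].
apply: (Ck_eq oU (f := fun x => 'D_v f x *: ('D_1 g \o f) x)) => [x Ux|].
  have dfx := df _ Ux; have dgx := dg _ (fUA _ Ux).
  rewrite (deriveE v (differentiable_comp dfx dgx)) (diff_comp dfx dgx) /=.
  by rewrite -(deriveE v dfx) (deriveE _ dgx) -linearZ /= /GRing.scale /= mulr1.
apply: Ck_scale => //; first exact: Df.
exact: (IH _ (CkW Cf) (Dg _)).
Qed.

Lemma CkM (V : normedModType R) k (U : set V) (f g : V -> R) : open U ->
  Ck k U f -> Ck k U g -> Ck k U (fun x => f x * g x).
Proof. by move=> oU; exact: (@Ck_scale R V U oU R). Qed.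

Lemma CkD_real (V : normedModType R) k (U : set V) (f g : V -> R) : open U ->
  Ck k U f -> Ck k U g -> Ck k U (fun x => f x + g x).
Proof. by move=> oU; exact: (CkD oU). Qed.

Lemma CkV (V : normedModType R) k (U : set V) (f : V -> R) : open U ->
  (forall x, U x -> f x != 0) -> Ck k U f -> Ck k U (fun x => (f x)^-1).
Proof.
move=> oU f0; elim: k => [|k IH] Cf.
  by move=> x Ux; apply: cvgV; [exact: f0 | exact: Cf].
have [df Df] := Cf; have Ci := IH (CkW Cf).
split=> [x Ux|v]; first by apply: differentiableV; [exact: df|exact: f0].
apply: (Ck_eq oU (f := fun x => (-1) * (((f x)^-1 * (f x)^-1) * 'D_v f x))).
  move=> x Ux; rewrite deriveV; [|exact: f0|exact/diff_derivable/df].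
  by rewrite -exprVn expr2 mulN1r -mulNr.
apply: CkM => //; first exact: Ck_cst.
by apply: CkM; [|exact: CkM|exact: Df].
Qed.

(** exp(-1/x) times 1/x^n, extended by 0 to x <= 0. The derivative of a member
    of this family is a combination of two others, so that all of them are
    smooth at once. *)
Definition flat (n : nat) (x : R) : R :=
  if 0 < x then x^-1 ^+ n * expR (- x^-1) else 0.

Lemma flatS n x : flat n.+1 x = x^-1 * flat n x.
Proof. by rewrite /flat; case: ifP => _; rewrite ?mulr0// exprS mulrA. Qed.

(** At y = 1/x > 0 the exponential series gives exp y >= y^(n+1) / (n+1)!,
    which exceeds y^n by a factor of order 1/x. *)
Lemma flat_bound n x : `|flat n x| <= (n.+1)`!%:R * `|x|.
Proof.
rewrite /flat; case: ifPn => [x0|_]; last by rewrite normr0 mulr_ge0.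
have [y0 m0] : 0 < x^-1 /\ 0 < (n.+1)`!%:R :> R.
  by rewrite invr_gt0 x0 ltr0n fact_gt0.
rewrite gtr0_norm ?mulr_gt0 ?exprn_gt0 ?expR_gt0// gtr0_norm//.
rewrite expRN ler_pdivrMr ?expR_gt0//.
have : x^-1 ^+ n.+1 / (n.+1)`!%:R <= expR x^-1.
  by rewrite (le_trans _ (expR_ge1Dxn n (ltW y0)))// lerDr.
rewrite ler_pdivrMr// => le1.
have -> : x^-1 ^+ n = x * x^-1 ^+ n.+1.
  by rewrite exprS mulrA divff ?mul1r// lt0r_neq0.
by rewrite mulrAC [leRHS]mulrC ler_pM2l// mulrC.
Qed.

Lemma flat0 n : flat n 0 = 0. Proof. by rewrite /flat ltxx. Qed.

(** At 0 the difference quotient of [flat n] is [flat n.+1], which tends to 0 by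
    [flat_bound]. *)
Lemma flat_derive n x :
  is_derive (x : R) (1 : R) (flat n) (flat n.+2 x - n%:R * flat n.+1 x).
Proof.
have [->|x0] := eqVneq x 0.
  rewrite !flat0 mulr0 subr0.
  suff H : h^-1 *: (flat n (h *: 1 + 0) - flat n 0) @[h --> 0^'] --> (0 : R).
    apply: DeriveDef; first by apply/cvg_ex; exists 0; exact: H.
    exact/cvg_lim.
  have E : (fun h : R => h^-1 *: (flat n (h *: 1 + 0) - flat n 0)) = flat n.+1.
    by apply/funext => h; rewrite flat0 subr0 addr0 flatS /GRing.scale /= mulr1.
  rewrite E; apply/cvgrPdist_le => e e0.
  near=> h; rewrite sub0r normrN (le_trans (flat_bound _ _))//.
  rewrite -ler_pdivlMl ?ltr0n ?fact_gt0//.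
  near: h; apply: (@dnbhs0_le _ R); rewrite mulr_gt0// invr_gt0 ltr0n fact_gt0.
elim: n => [|n IH].
  rewrite mul0r subr0.
  have [xp|xn] := ltP 0 x.
    apply: (@near_eq_is_derive R R R (fun x => expR (- x^-1))).
    - near=> y; rewrite /flat ifT ?mul1r//.
      by near: y; exact: lt_nbhsr.
    - have -> : flat 2 x = expR (- x^-1) * (- (- x ^- 2)).
        by rewrite /flat xp opprK mulrC exprVn.
      have D : is_derive x 1 (fun y : R => - y^-1) (- (- x ^- 2)).
        apply: is_deriveN; have := @is_deriveV _ id x 1 1 x0 _.
        by rewrite /GRing.scale /= mulr1; apply.
      exact: (is_derive1_comp (is_derive_expR _) D).
  have {}xn : x < 0 by rewrite lt_neqAle x0.
  apply: (@near_eq_is_derive R R R (cst 0)).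
  - near=> y; rewrite /flat ifF//; apply/negbTE; rewrite -leNgt ltW//.
    by near: y; exact: lt_nbhsl.
  - by rewrite /flat ifF ?(lt_gtF xn)//; exact: is_derive_cst.
have -> : flat n.+1 = (fun y => y^-1) * flat n.
  by apply/funext => y; rewrite flatS.
have D : is_derive x 1 (fun y : R => y^-1) (- x ^- 2).
  have := @is_deriveV _ id x 1 1 x0 _.
  by rewrite /GRing.scale /= mulr1; apply.
apply: is_derive_eq.
rewrite /GRing.scale /= !flatS -natr1 -exprVn; ring.
Unshelve. all: by end_near. Qed.

Lemma Ck_flat k n (U : set R) : open U -> Ck k U (flat n).
Proof.
move=> oU; elim: k n => [|k IH] n.
  move=> x _; apply: differentiable_continuous.
  by apply/derivable1_diffP; have [] := flat_derive n x.
have df x : differentiable (flat n) x.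
  by apply/derivable1_diffP; have [] := flat_derive n x.
split=> // v.
apply: (Ck_eq oU (f := fun x => v * (flat n.+2 x + (- n%:R) * flat n.+1 x))).
  move=> x _; rewrite (deriveE v (df x)).
  rewrite -[v in RHS]mulr1 -[v * 1]/(v *: (1:R)) linearZ -(deriveE _ (df x)).
  by rewrite (@derive_val _ _ _ _ _ _ _ (flat_derive n x)) mulNr.
apply: CkM => //; first exact: Ck_cst.
apply: CkD_real => //.
by apply: CkM => //; exact: Ck_cst.
Qed.

Lemma flat_ge0 n x : 0 <= flat n x.
Proof.
rewrite /flat; case: ifPn => // x0.
by rewrite mulr_ge0 ?expR_ge0 ?exprn_ge0 ?invr_ge0 ?ltW.
Qed.

Definition step (x : R) : R := flat 0 x / (flat 0 x + flat 0 (1 - x)).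

Lemma step_den_gt0 x : 0 < flat 0 x + flat 0 (1 - x).
Proof.
have [x0|x0] := ltP 0 x.
  by apply: ltr_wpDr; rewrite ?flat_ge0// /flat x0 mul1r expR_gt0.
apply: ltr_wpDl; rewrite ?flat_ge0// /flat ifT ?mul1r ?expR_gt0//.
by rewrite subr_gt0 (le_lt_trans x0).
Qed.

Lemma smooth_step (U : set R) : open U -> smooth_on U step.
Proof.
move=> oU k; apply: CkM => //; first exact: Ck_flat.
apply: CkV => //; first by move=> x _; rewrite gt_eqF ?step_den_gt0.
apply: CkD_real => //; first exact: Ck_flat.
apply: (@Ck_comp_real R R k U setT (fun x => 1 - x)) => //.
- exact: openT.
- apply: CkD_real => //; first exact: Ck_cst.
  apply: (Ck_eq oU (f := fun x => (-1) * x)) => [x _|]; first by rewrite mulN1r.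
  by apply: CkM => //; [exact: Ck_cst|exact: Ck_id].
- by apply: Ck_flat; exact: openT.
Qed.

Lemma step_le0 x : x <= 0 -> step x = 0.
Proof. by move=> x0; rewrite /step {1}/flat ltNge x0 mul0r. Qed.

Lemma step_ge1 x : 1 <= x -> step x = 1.
Proof.
move=> x1; have := step_den_gt0 x; rewrite /step.
have -> : flat 0 (1 - x) = 0 by rewrite /flat subr_gt0 ltNge x1.
by rewrite addr0 => d0; rewrite divff// lt0r_neq0.
Qed.

Lemma step_itv x : 0 <= step x <= 1.
Proof.
have d0 := step_den_gt0 x.
apply/andP; split; first by rewrite divr_ge0 ?flat_ge0 ?(ltW d0).
by rewrite ler_pdivrMr// mul1r lerDl flat_ge0.
Qed.

(** The projections of the cells involve [pi_set], which is not smooth at 0 and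
    1. A function that factors through [step] is smooth nevertheless. *)
Lemma step_pi_set x : step (pi_set x) = step x.
Proof.
rewrite /pi_set; have [x0|x0] := leP x 0.
  by rewrite (min_r (le_trans x0 ler01)) (max_l x0) !step_le0.
have [x1|x1] := leP 1 x; last by rewrite (max_r (ltW x0)).
by rewrite (max_r ler01) !step_ge1.
Qed.

End SmoothReal.

(** * Configurations of little intervals *)

(* Case analysis on comparisons of indices; [index_congr] closes the remaining
   equalities between terms that differ only by the way an index is written. *)
Ltac case_ifs := repeat (case: ifPn => ?); try lia.

Ltac index_congr := first [reflexivity | lia | f_equal; index_congr].

Section Configurations.
Context {R : realType}.
Implicit Types C D E : nat -> R * R.

(** The i-th interval is given by its left end and its length. The strict
    inequality between two intervals leaves a gap. *)
Definition valid n C : Prop :=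
  (forall i, (i < n)%N ->
     [/\ 0 <= (C i).1, 0 < (C i).2 & (C i).1 + (C i).2 <= 1])
  /\ (forall i j, (i < j < n)%N -> (C i).1 + (C i).2 < (C j).1).

(** Composition, if (a, w) is read as the affine map x |-> a + w * x of [0, 1]
    onto the interval. *)
Definition aff (p q : R * R) : R * R := (p.1 + p.2 * q.1, p.2 * q.2).

Lemma affA p q r : aff p (aff q r) = aff (aff p q) r.
Proof. by rewrite /aff /=; congr (_, _); ring. Qed.

(** Substitution in the operad of little intervals, for D of arity s. *)
Definition plug k s C D (i : nat) : R * R :=
  if (i < k)%N then C i
  else if (i < k + s)%N then aff (C k) (D (i - k)%N) else C (i - s.-1)%N.

Definition mix (l : R) C D (i : nat) : R * R :=
  ((1 - l) * (C i).1 + l * (D i).1, (1 - l) * (C i).2 + l * (D i).2).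

(** All the intervals, and all the gaps between them, have length
    1 / (2n - 1). *)
Definition std_cfg n (i : nat) : R * R :=
  ((i.*2)%:R / (n.*2.-1)%:R, (n.*2.-1)%:R^-1).

(** This and [plug_disjoint] are the two associativity laws of an operad. *)
Lemma plug_nested k s j s' C D E :
  (1 < s')%N -> (s' < s)%N -> (j + s' <= s)%N ->
  plug k s C (plug j s' D E) =
  plug (k + j) s' (plug k (s - s'.-1) C D) E.
Proof.
move=> s1 ss js; apply/funext => i; rewrite /plug.
by case_ifs; rewrite ?affA; index_congr.
Qed.

Lemma plug_disjoint k s k' s' C D E :
  (1 < s)%N -> (1 < s')%N -> (k + s <= k')%N ->
  plug k s (plug (k' - s.-1) s' C E) D = plug k' s' (plug k s C D) E.
Proof.
move=> s1 s1' kk; apply/funext => i; rewrite /plug.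
by case_ifs; index_congr.
Qed.

Lemma mix_id l C : mix l C C = C.
Proof.
by apply/funext => i; rewrite /mix [RHS]surjective_pairing; congr (_, _); ring.
Qed.

Lemma mix0 C D : mix 0 C D = C.
Proof.
by apply/funext => i; rewrite /mix [RHS]surjective_pairing; congr (_, _); ring.
Qed.

Lemma mix1 C D : mix 1 C D = D.
Proof.
by apply/funext => i; rewrite /mix [RHS]surjective_pairing; congr (_, _); ring.
Qed.

Lemma valid_std_cfg n : valid n (std_cfg n).
Proof.
rewrite /valid /std_cfg /=; case: n => [|n]; first by split=> [i|i j /andP[]].
have d0 : 0 < n.+1.*2.-1%:R :> R by rewrite ltr0n; lia.
split=> [i ltin|i j /andP[ij jn]].
  split; [by rewrite divr_ge0 | by rewrite invr_gt0 |].
  by rewrite -[X in _ + X]mul1r -mulrDl ler_pdivrMr// mul1r natr1 ler_nat; lia.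
rewrite -[X in _ + X]mul1r -mulrDl ltr_pM2r ?invr_gt0// natr1 ltr_nat; lia.
Qed.

Lemma conv_gt0 (l x y : R) : 0 <= l <= 1 -> 0 < x -> 0 < y ->
  0 < (1 - l) * x + l * y.
Proof.
move=> /andP[l0 l1] x0 y0; have [->|l0'] := eqVneq l 0; first lra.
apply: ltr_wpDl; first by rewrite mulr_ge0 ?subr_ge0 ?(ltW x0).
by rewrite mulr_gt0// lt0r l0'.
Qed.

(** Every inequality in [valid] is affine in the ends and the lengths. *)
Lemma valid_mix n l C D : 0 <= l <= 1 -> valid n C -> valid n D ->
  valid n (mix l C D).
Proof.
move=> l01 [C1 C2] [D1 D2]; have /andP[l0 l1] := l01.
split=> [i ltin|i j ijn] /=.
  have [c1 c2 c3] := C1 i ltin; have [d1 d2 d3] := D1 i ltin.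
  by split; [nra|exact: conv_gt0|nra].
have := C2 i j ijn; have := D2 i j ijn; rewrite -subr_gt0 => D0.
rewrite -subr_gt0 => C0; rewrite -subr_gt0.
by have := conv_gt0 l01 C0 D0; nra.
Qed.

Lemma valid_plug n k s C D : (0 < s)%N -> (k < n)%N -> valid n C -> valid s D ->
  valid (n + s.-1) (plug k s C D).
Proof.
move=> s0 kn [C1 C2] [D1 D2].
have [k1 k2 k3] := C1 k kn.
split=> [i ltin|i j /andP[ij jn]]; rewrite /plug.
  case_ifs; [by apply: C1; lia| |by apply: C1; lia].
  have [d1 d2 d3] := D1 (i - k)%N ltac:(lia).
  by rewrite /=; split; nra.
have Ci i' : (i' < n)%N -> 0 < (C i').2 by move=> /C1[].
case_ifs; rewrite ?/aff /=; try (by apply: C2; lia).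
- have [d1 d2 d3] := D1 (j - k)%N ltac:(lia).
  have := C2 i k ltac:(lia); nra.
- have [d1 d2 d3] := D1 (j - k)%N ltac:(lia).
  have := D2 (i - k)%N (j - k)%N ltac:(lia); nra.
- have [d1 d2 d3] := D1 (i - k)%N ltac:(lia).
  have := C2 k (j - s.-1)%N ltac:(lia); nra.
Qed.

End Configurations.

(** * Paths and their brackets *)

Section Brackets.
Context {R : realType}.
Implicit Types F G T U : nat -> R.

(** The paths F m = t_0 + ... + t_(m-1) - m of the points t of K_n, prolonged by
    -1 beyond n. *)
Definition lpath n F : Prop :=
  [/\ F 0%N = 0, F 1%N = -1, forall m, F m - 1 <= F m.+1,
      forall m, (0 < m)%N -> F m <= -1 & forall m, (n <= m)%N -> F m = -1].

(** The window of s steps that starts at k looks like a path of arity s moved to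
    height F k, except that its last step may end too high: the excess is the
    coordinate at k of the outer factor of the face. *)
Definition bracket n F k s : Prop :=
  [/\ [&& 1 < s, s < n & k + s <= n]%N,
      forall j, (0 < j < s)%N -> F (k + j)%N <= F k - 1 &
      F k - 1 <= F (k + s)%N].

(** The path of the outer factor of a face point: the window is shrunk to a
    single step. *)
Definition outer k s F m : R := if (m <= k)%N then F m else F (m + s.-1)%N.
(** The path of the inner factor: the window moved to the origin, with its end
    brought down to -1. *)
Definition inner k s F j : R := if (j < s)%N then F (k + j)%N - F k else -1.
(** The effect of [face_op] on paths; see [path_of_face]. *)
Definition insert k s T U m : R :=
  if (m <= k)%N then T m
  else if (m < k + s)%N then T k + U (m - k)%N else T (m - s.-1)%N.

Lemma lpath_outer n F k s : lpath n F -> bracket n F k s ->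
  lpath (n - s.-1) (outer k s F).
Proof.
move=> [F0 F1 FS Fn Fe] [/and3P[s1 sn ksn] B1 B2]; rewrite /outer; split.
- by [].
- case_ifs => //; have k0 : k = 0%N by lia.
  move: B2 (Fn s ltac:(lia)); rewrite k0 F0 !add0n add1n prednK ?(ltnW s1)//.
  by move=> *; lra.
- move=> m; case_ifs; [exact: FS| |exact: FS].
  have -> : m = k by lia.
  by have -> : (k.+1 + s.-1 = k + s)%N by lia.
- by move=> m m0; case_ifs; apply: Fn; lia.
- by move=> m nm; case_ifs; apply: Fe; lia.
Qed.

Lemma lpath_inner n F k s : lpath n F -> bracket n F k s ->
  lpath s (inner k s F).
Proof.
move=> [F0 F1 FS Fn Fe] [/and3P[s1 sn ksn] B1 B2]; rewrite /inner; split.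
- by rewrite ifT ?addn0 ?subrr//; lia.
- rewrite ifT//; have := B1 1%N s1; have := FS k; rewrite addn1; lra.
- move=> m; case_ifs; last lra.
    by have := FS (k + m)%N; rewrite addnS; lra.
  have [m0|m0] := posnP m; first lia.
  by have := B1 m ltac:(lia); lra.
- by move=> m m0; case_ifs; last lra; have := B1 m ltac:(lia); lra.
- by move=> m nm; case_ifs.
Qed.

Lemma lpath_insert r s k T U : (1 < r)%N -> (1 < s)%N -> (k < r)%N ->
  lpath r T -> lpath s U -> lpath (r + s.-1) (insert k s T U).
Proof.
move=> r1 s1 kr [T0 T1 TS Tn Te] [U0 U1 US Un Ue]; rewrite /insert; split.
- by [].
- case_ifs => //; have -> : k = 0%N by lia.
  by rewrite T0 add0r subn0.
- move=> m; case_ifs; try exact: TS.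
  + have -> : m = k by lia.
    by rewrite subSnn U1.
  + by have := US (m - k)%N; rewrite (_ : (m - k).+1 = m.+1 - k)%N; [lra|lia].
  + have -> : (m.+1 - s.-1 = k.+1)%N by lia.
    have := TS k; have := Un (m - k)%N ltac:(lia); lra.
  + have -> : (m.+1 - s.-1 = (m - s.-1).+1)%N by lia.
    exact: TS.
- move=> m m0; case_ifs; try (by apply: Tn; lia).
  have := Un (m - k)%N ltac:(lia).
  have [->|k0] := posnP k; first by rewrite T0; lra.
  have := Tn k k0; lra.
- by move=> m nm; case_ifs; apply: Te; lia.
Qed.

Lemma bracket_insert r s k T U : (1 < r)%N -> (1 < s)%N -> (k < r)%N ->
  lpath r T -> lpath s U -> bracket (r + s.-1) (insert k s T U) k s.
Proof.
move=> r1 s1 kr [T0 T1 TS Tn Te] [U0 U1 US Un Ue]; rewrite /insert; split.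
- lia.
- move=> j js; case_ifs.
  by have := Un j ltac:(lia); rewrite addKn; lra.
- case_ifs; have -> : (k + s - s.-1 = k.+1)%N by lia.
  exact: TS.
Qed.

Lemma outer_insert s k T U : (1 < s)%N -> outer k s (insert k s T U) = T.
Proof.
move=> s1; apply/funext => m; rewrite /outer /insert.
by case_ifs => //; index_congr.
Qed.

Lemma inner_insert s k T U : lpath s U -> inner k s (insert k s T U) = U.
Proof.
move=> [U0 U1 US Un Ue]; apply/funext => m; rewrite /inner /insert; case_ifs.
- by rewrite (_ : m = 0%N) ?U0 ?addn0 ?subrr//; lia.
- by rewrite addKn; lra.
- by rewrite Ue//; lia.
Qed.

(** If the second window started inside the first one and ended after it, then F
    at the end of the first window would lie below F k' and hence at or below
    F k - 2, whereas the first bracket keeps it at or above F k - 1. *)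
Lemma bracket_no_cross n F k s k' s' : bracket n F k s -> bracket n F k' s' ->
  (k < k' < k + s)%N -> (k' + s' <= k + s)%N.
Proof.
move=> [_ B1 B2] [_ B1' B2'] kk; rewrite leqNgt; apply/negP => cr.
have := B1 (k' - k)%N ltac:(lia).
have := B1' (k + s - k')%N ltac:(lia).
by rewrite !subnKC; [lra|lia|lia].
Qed.

Section Nested.
Variables (n : nat) (F : nat -> R) (k s k' s' : nat).
Hypotheses (B : bracket n F k s) (B' : bracket n F k' s').
Hypotheses (kk' : (k <= k')%N) (ks' : (k' + s' <= k + s)%N) (ss' : (s' < s)%N).

Lemma bracket_inner_nested : bracket s (inner k s F) (k' - k) s'.
Proof.
have [/and3P[s1 sn ksn] B1 B2] := B; have [/and3P[s1' sn' ksn'] B1' B2'] := B'.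
rewrite /inner; split; first lia.
  move=> j js; case_ifs.
  have -> : (k + (k' - k + j) = k' + j)%N by lia.
  by rewrite subnKC//; have := B1' j js; lra.
case_ifs; rewrite subnKC//.
  rewrite (_ : k + (k' - k + s') = k' + s')%N; [lra|lia].
have := B1 (k' - k)%N ltac:(lia).
by rewrite subnKC//; lra.
Qed.

Lemma bracket_outer_nested : bracket (n - s'.-1) (outer k' s' F) k (s - s'.-1).
Proof.
have [/and3P[s1 sn ksn] B1 B2] := B; have [/and3P[s1' sn' ksn'] B1' B2'] := B'.
rewrite /outer; split; first lia.
  move=> j js; case_ifs; first by apply: B1; lia.
  have -> : (k + j + s'.-1 = k + (j + s'.-1))%N by lia.
  by apply: B1; lia.
case_ifs.
by have -> : (k + (s - s'.-1) + s'.-1 = k + s)%N by lia.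
Qed.

Lemma outer_inner_nested :
  outer (k' - k) s' (inner k s F) = inner k (s - s'.-1) (outer k' s' F).
Proof.
have [/and3P[s1 sn ksn] B1 B2] := B; have [/and3P[s1' sn' ksn'] B1' B2'] := B'.
by apply/funext => m; rewrite /outer /inner; case_ifs => //; index_congr.
Qed.

Lemma inner_inner_nested :
  inner (k' - k) s' (inner k s F) = inner k' s' F.
Proof.
have [/and3P[s1 sn ksn] B1 B2] := B; have [/and3P[s1' sn' ksn'] B1' B2'] := B'.
apply/funext => m; rewrite /inner; case_ifs => //.
rewrite subnKC// -[LHS]addrA opprB addrA.
have -> : (k + (k' - k + m) = k' + m)%N by lia.
lra.
Qed.

Lemma outer_outer_nested :
  outer k (s - s'.-1) (outer k' s' F) = outer k s F.
Proof.
have [/and3P[s1 sn ksn] B1 B2] := B; have [/and3P[s1' sn' ksn'] B1' B2'] := B'.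
by apply/funext => m; rewrite /outer; case_ifs => //; index_congr.
Qed.

End Nested.

Section Disjoint.
Variables (n : nat) (F : nat -> R) (k s k' s' : nat).
Hypotheses (B : bracket n F k s) (B' : bracket n F k' s').
Hypotheses (kk' : (k + s <= k')%N).

Lemma bracket_outer_left : bracket (n - s.-1) (outer k s F) (k' - s.-1) s'.
Proof.
have [/and3P[s1 sn ksn] B1 B2] := B; have [/and3P[s1' sn' ksn'] B1' B2'] := B'.
rewrite /outer; split; first lia.
  move=> j js; case_ifs.
  have -> : (k' - s.-1 + j + s.-1 = k' + j)%N by lia.
  have -> : (k' - s.-1 + s.-1 = k')%N by lia.
  exact: B1'.
case_ifs.
have -> : (k' - s.-1 + s' + s.-1 = k' + s')%N by lia.
by have -> : (k' - s.-1 + s.-1 = k')%N by lia.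
Qed.

Lemma bracket_outer_right : bracket (n - s'.-1) (outer k' s' F) k s.
Proof.
have [/and3P[s1 sn ksn] B1 B2] := B; have [/and3P[s1' sn' ksn'] B1' B2'] := B'.
rewrite /outer; split; first lia.
  by move=> j js; case_ifs; apply: B1.
by case_ifs.
Qed.

Lemma outer_outer_disjoint :
  outer (k' - s.-1) s' (outer k s F) = outer k s (outer k' s' F).
Proof.
have [/and3P[s1 sn ksn] B1 B2] := B; have [/and3P[s1' sn' ksn'] B1' B2'] := B'.
by apply/funext => m; rewrite /outer; case_ifs => //; index_congr.
Qed.

Lemma inner_outer_left :
  inner (k' - s.-1) s' (outer k s F) = inner k' s' F.
Proof.
have [/and3P[s1 sn ksn] B1 B2] := B; have [/and3P[s1' sn' ksn'] B1' B2'] := B'.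
by apply/funext => m; rewrite /outer /inner; case_ifs => //; index_congr.
Qed.

Lemma inner_outer_right : inner k s (outer k' s' F) = inner k s F.
Proof.
have [/and3P[s1 sn ksn] B1 B2] := B; have [/and3P[s1' sn' ksn'] B1' B2'] := B'.
by apply/funext => m; rewrite /outer /inner; case_ifs => //; index_congr.
Qed.

End Disjoint.

End Brackets.

(** * The configuration attached to a path *)

Section Gauge.
Context {R : realType}.
Implicit Types F G : nat -> R.

(** The partial sums of (0, 1/2, ..., 1/2, n/2) shifted as in [lpath]. *)
Definition bary_path n m : R :=
  if m == 0%N then 0 else if (m < n)%N then - (m.+1)%:R / 2 else -1.

Definition cone_path n a G m : R := (1 - a) * G m + a * bary_path n m.

(** In terms of coordinates these are t_m and m - (t_0 + ... + t_m), the two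
    functions that are nonnegative on K_n, divided by their values 1/2 and m/2
    at the barycenter. *)
Definition slack m F : R :=
  Num.min (2 * (F m.+1 - F m + 1)) (2 * (-1 - F m.+1) / m%:R).

(** The radial coordinate, 0 on the faces and 1 at the barycenter: being a
    minimum of affine functions with value 1 at the barycenter, it is affine on
    the segments that end there ([gauge_cone]). The initial value 1 behaves like
    one more such function. *)
Definition gauge n F : R := \big[Num.min/1]_(i < n.-2) slack i.+1 F.

(** Projection to the boundary from the barycenter. At the barycenter itself it
    yields a meaningless value, which enters [cfg] with weight 0. *)
Definition recenter n F m : R :=
  (F m - gauge n F * bary_path n m) / (1 - gauge n F).

Lemma min_affine (a x y : R) : 0 <= a <= 1 ->
  Num.min ((1 - a) * x + a) ((1 - a) * y + a) = (1 - a) * Num.min x y + a.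
Proof.
move=> /andP[a0 a1]; have [xy|yx] := leP x y.
  by rewrite min_l// lerD2r ler_wpM2l// subr_ge0.
by rewrite min_r// lerD2r ler_wpM2l ?subr_ge0// ltW.
Qed.

Lemma slack_cone n G a m : 0 <= a <= 1 -> (m.+2 < n)%N ->
  slack m.+1 (cone_path n a G) = (1 - a) * slack m.+1 G + a.
Proof.
move=> a01 mn; rewrite /slack -min_affine// /cone_path /bary_path /=.
rewrite mn (ltnW mn); congr Num.min; rewrite -?(natr1 m.+2) -?(natr1 m.+1).
  by field.
have : (m.+1%:R : R) != 0 by rewrite pnatr_eq0.
by move=> m0; field.
Qed.

Lemma gauge_cone n G a : 0 <= a <= 1 ->
  gauge n (cone_path n a G) = (1 - a) * gauge n G + a.
Proof.
move=> a01; rewrite /gauge.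
elim/big_rec2 : _ => [|i x y _ ->]; first by ring.
by rewrite slack_cone// ?min_affine//; have := ltn_ord i; lia.
Qed.

Lemma gauge_le n F m : (0 < m < n.-1)%N -> gauge n F <= slack m F.
Proof.
case: m => // m mn; have mn' : (m < n.-2)%N by lia.
rewrite /gauge (bigD1 (Ordinal mn'))//= ge_min lexx//.
Qed.

Lemma gauge_ge0 n F : lpath n F -> 0 <= gauge n F.
Proof.
move=> [F0 F1 FS Fn Fe]; rewrite /gauge.
elim/big_ind : _ => // [x y x0 y0|i _]; first by rewrite le_min x0.
rewrite /slack le_min; apply/andP; split.
  by have := FS i.+1; lra.
by rewrite divr_ge0 ?ler0n//; have := Fn i.+2 isT; lra.
Qed.

(** A bracket makes one of the inequalities of K_n an equality: a window that
    starts at k > 0 forces the coordinate t_k to vanish, and one that starts at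
    0 forces the sum of its s coordinates to take its maximal value s - 1. *)
Lemma bracket_gauge n F k s : lpath n F -> bracket n F k s -> gauge n F = 0.
Proof.
move=> pF [/and3P[s1 sn ksn] B1 B2]; apply/le_anti; rewrite gauge_ge0// andbT.
have [F0 F1 FS Fn Fe] := pF.
have [k0|k0] := posnP k.
  apply: (le_trans (@gauge_le n F s.-1 _)); first lia.
  rewrite /slack ge_min prednK ?(ltnW s1)//; apply/orP; right.
  move: B2; rewrite k0 F0 add0n => B2; have := Fn s (ltnW s1) => Fs.
  by rewrite (_ : -1 - F s = 0) ?mulr0 ?mul0r//; lra.
apply: (le_trans (@gauge_le n F k _)); first lia.
rewrite /slack ge_min; apply/orP; left.
by have := B1 1%N s1; rewrite addn1; lra.
Qed.

Lemma recenter_cone n G a : 0 <= a < 1 -> gauge n G = 0 ->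
  recenter n (cone_path n a G) = G.
Proof.
move=> /andP[a0 a1] g0; apply/funext => m.
rewrite /recenter gauge_cone ?a0 ?ltW// g0 mulr0 add0r /cone_path addrK.
by rewrite mulrAC divff ?mul1r// subr_eq0 gt_eqF.
Qed.

Lemma cone_path0 n G : cone_path n 0 G = G.
Proof. by apply/funext => m; rewrite /cone_path subr0 mul1r mul0r addr0. Qed.

Lemma recenter_id n G : gauge n G = 0 -> recenter n G = G.
Proof.
by move=> g0; rewrite -{1}(cone_path0 n G) recenter_cone// lexx ltr01.
Qed.

(** Both factors of a face have smaller arity, so that N >= n is enough fuel.
    Any bracket of the projected point may be used, by
    [split_cfg_confluence]. *)
Fixpoint cfg_rec N n F : nat -> R * R :=
  if N is N'.+1 then
    let G := recenter n F in
    let p := xget (0, 0)%N [set p | bracket n G p.1 p.2] in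
    mix (step (gauge n F))
      (if `[< bracket n G p.1 p.2 >] then
         plug p.1 p.2 (cfg_rec N' (n - p.2.-1)%N (outer p.1 p.2 G))
           (cfg_rec N' p.2 (inner p.1 p.2 G))
       else std_cfg n)
      (std_cfg n)
  else std_cfg n.

Definition cfg n F := cfg_rec n n F.

(** What the face given by the bracket (k, s) prescribes. *)
Definition split_cfg n F k s :=
  plug k s (cfg (n - s.-1) (outer k s F)) (cfg s (inner k s F)).

Lemma cfg_rec_small n N F : (n <= 2)%N -> cfg_rec N n F = std_cfg n.
Proof.
case: N => //= N n2; rewrite asboolF ?mix_id// => -[]; lia.
Qed.

Lemma cfg_rec_fuel N N' n F : (n <= N)%N -> (n <= N')%N ->
  cfg_rec N n F = cfg_rec N' n F.
Proof.
elim: N N' n F => [|N IH] [|N'] n F nN nN';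
  try by rewrite !cfg_rec_small//; lia.
rewrite /=; congr mix; case: asboolP => // -[/and3P[s1 sn _] _ _].
by congr plug; apply: IH; lia.
Qed.

Lemma cfgE n F (G := recenter n F)
    (p := xget (0, 0)%N [set p | bracket n G p.1 p.2]) :
  cfg n F = mix (step (gauge n F))
    (if `[< bracket n G p.1 p.2 >] then split_cfg n G p.1 p.2 else std_cfg n)
    (std_cfg n).
Proof.
rewrite /cfg; case: n F @G @p => [|n] F G p.
  by rewrite asboolF ?mix_id// => -[]; lia.
rewrite [LHS]/= -/G -/p; clearbody p; congr mix.
case: asboolP => // -[/and3P[s1 sn _] _ _].
by rewrite /split_cfg /cfg; congr plug; apply: cfg_rec_fuel => //; lia.
Qed.

Lemma valid_cfg n F : valid n (cfg n F).
Proof.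
elim/ltn_ind : n F => n IH F; rewrite cfgE; apply: valid_mix.
- exact: step_itv.
- case: asboolP => [|_]; last exact: valid_std_cfg.
  move=> -[/and3P[s1 sn ksn] _ _]; rewrite /split_cfg.
  set p := xget _ _ in s1 sn ksn *.
  have {1}-> : (n = n - p.2.-1 + p.2.-1)%N by lia.
  by apply: valid_plug; try lia; apply: IH; lia.
- exact: valid_std_cfg.
Qed.

(** At a path with a bracket the gauge vanishes, so that [cfg] is one of the
    prescriptions of its brackets. *)
Lemma cfg_bracket_of_confluence n F :
  (forall k s k' s', bracket n F k s -> bracket n F k' s' ->
     split_cfg n F k s = split_cfg n F k' s') ->
  forall k s, lpath n F -> bracket n F k s -> cfg n F = split_cfg n F k s.
Proof.
move=> conf k s pF B; have g0 := bracket_gauge pF B.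
rewrite cfgE g0 (recenter_id g0) step_le0// mix0.
have B' : bracket n F (xget (0, 0)%N [set p | bracket n F p.1 p.2]).1
                    (xget (0, 0)%N [set p | bracket n F p.1 p.2]).2.
  by apply: (@xgetPex _ (0,0)%N [set p | bracket n F p.1 p.2]); exists (k, s).
by rewrite asboolT//; exact: conf.
Qed.

(** Two brackets are nested or disjoint. Then each is still a bracket of one of
    the factors with respect to the other, and the induction hypothesis allows
    to split that factor along it; the two resulting double splittings agree by
    [plug_nested] or [plug_disjoint]. *)
Lemma split_cfg_confluence n F k s k' s' : lpath n F ->
  bracket n F k s -> bracket n F k' s' ->
  split_cfg n F k s = split_cfg n F k' s'.
Proof.
elim/ltn_ind : n F k s k' s' => n IH.
have IHc m G k s : (m < n)%N -> lpath m G -> bracket m G k s ->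
    cfg m G = split_cfg m G k s.
  move=> mn pG; apply: cfg_bracket_of_confluence => // k1 s1 k2 s2.
  exact: IH.
have nested F k s k' s' : lpath n F -> bracket n F k s -> bracket n F k' s' ->
    (k <= k')%N -> (k' + s' <= k + s)%N ->
    split_cfg n F k s = split_cfg n F k' s'.
  move=> pF B B' kk ks.
  have [/and3P[s1 sn ksn] _ _] := B; have [/and3P[s1' sn' ksn'] _ _] := B'.
  have [ss|ss] := ltnP s' s; last first.
    by have [-> ->] : k = k' /\ s = s' by lia.
  rewrite /split_cfg.
  rewrite (IHc _ _ _ _ sn (lpath_inner pF B)
    (bracket_inner_nested B B' kk ks ss)).
  have lt' : (n - s'.-1 < n)%N by lia.
  rewrite (IHc _ _ _ _ lt' (lpath_outer pF B')
    (bracket_outer_nested B B' kk ks ss)).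
  rewrite /split_cfg (outer_inner_nested B B' kk ks ss).
  rewrite (inner_inner_nested B B' kk ks ss) (outer_outer_nested B B' kk ks ss).
  rewrite plug_nested//; last lia.
  rewrite subnKC//; congr plug; congr plug; congr cfg; lia.
have disj F k s k' s' : lpath n F -> bracket n F k s -> bracket n F k' s' ->
    (k + s <= k')%N -> split_cfg n F k s = split_cfg n F k' s'.
  move=> pF B B' kk.
  have [/and3P[s1 sn ksn] _ _] := B; have [/and3P[s1' sn' ksn'] _ _] := B'.
  rewrite /split_cfg.
  have lt : (n - s.-1 < n)%N by lia.
  rewrite (IHc _ _ _ _ lt (lpath_outer pF B) (bracket_outer_left B B' kk)).
  have lt' : (n - s'.-1 < n)%N by lia.
  rewrite (IHc _ _ _ _ lt' (lpath_outer pF B')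
    (bracket_outer_right B B' kk)).
  rewrite /split_cfg (outer_outer_disjoint B B' kk) (inner_outer_left B B' kk).
  rewrite (inner_outer_right B B' kk) plug_disjoint//.
  congr plug; congr plug; congr cfg; lia.
move=> F k s k' s' pF B B'.
have [d|d] := leqP (k + s) k'; first exact: disj.
have [d'|d'] := leqP (k' + s') k; first by apply/esym/disj.
have [lt|gt|e] := ltngtP k k'.
- apply: nested => //; [exact: ltnW|].
  by apply: (bracket_no_cross B B'); rewrite lt.
- apply/esym/nested => //; [exact: ltnW|apply: (bracket_no_cross B' B)].
  by rewrite gt.
- have [ss|ss] := leqP (k' + s') (k + s).
    by apply: nested => //; rewrite e.
  by apply/esym/nested => //; [rewrite e|exact: ltnW].
Qed.

Lemma cfg_bracket n F k s : lpath n F -> bracket n F k s ->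
  cfg n F = split_cfg n F k s.
Proof.
move=> pF; apply: cfg_bracket_of_confluence => // k1 s1 k2 s2.
exact: split_cfg_confluence.
Qed.

Lemma cfg_insert r s k T U : (1 < r)%N -> (1 < s)%N -> (k < r)%N ->
  lpath r T -> lpath s U ->
  cfg (r + s.-1) (insert k s T U) = plug k s (cfg r T) (cfg s U).
Proof.
move=> r1 s1 kr pT pU.
rewrite (cfg_bracket (lpath_insert r1 s1 kr pT pU)
  (bracket_insert r1 s1 kr pT pU)).
by rewrite /split_cfg outer_insert// inner_insert// addnK.
Qed.

Lemma cfg_cone n G k s a : lpath n G -> bracket n G k s -> 0 <= a <= 1 ->
  cfg n (cone_path n a G) = mix (step a) (cfg n G) (std_cfg n).
Proof.
move=> pG B a01; have g0 := bracket_gauge pG B.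
rewrite [LHS]cfgE gauge_cone// g0 mulr0 add0r.
have /andP[a0] := a01; rewrite le_eqVlt => /orP[/eqP ->|a1].
  by rewrite step_ge1// !mix1.
rewrite recenter_cone ?a0//; congr mix.
by rewrite [RHS]cfgE g0 step_le0// mix0 recenter_id.
Qed.

End Gauge.

(** * Smoothness of the configurations along the cells *)

Section PathOf.
Context {R : realType}.

(** Stopping the sum at n makes the path stay at -1 afterwards. *)
Definition path_of n (t : 'rV[R]_n) (m : nat) : R :=
  \sum_(0 <= i < minn m n) coord t i - (minn m n)%:R.

Lemma path_of0 n (t : 'rV[R]_n) : path_of t 0 = 0.
Proof. by rewrite /path_of min0n big_nil subr0. Qed.

Lemma path_ofS n (t : 'rV[R]_n) m : path_of t m.+1 =
  path_of t m + (if (m < n)%N then coord t m - 1 else 0).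
Proof.
rewrite /path_of; case: ltnP => mn.
  by rewrite (minn_idPl mn) big_nat_recr//= -natr1; ring.
by rewrite (minn_idPr (leqW mn)) addr0.
Qed.

Lemma lpath_path_of n (t : 'rV[R]_n) : (1 < n)%N -> associahedron t ->
  lpath n (path_of t).
Proof.
move=> n1 At; have [Sn Sle tge] := associahedron_sum n1 At.
have en : n%:R = n.-1%:R + 1 :> R by rewrite natr1 prednK// ltnW.
have [t0 _ _] := At; split.
- exact: path_of0.
- by rewrite path_ofS path_of0 (ltnW n1) t0; ring.
- move=> m; rewrite path_ofS; case: ifP => mn; last lra.
  by have := tge m mn; lra.
- move=> m m0; rewrite /path_of; have [mn|nm] := leqP m n.
    have := Sle m ltac:(lia).
    by rewrite (_ : m%:R = m.-1%:R + 1 :> R); [lra|rewrite natr1 prednK].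
  by rewrite Sn en; lra.
- by move=> m nm; rewrite /path_of (minn_idPr nm) Sn en; lra.
Qed.

(** Both paths start at 0, so it suffices to compare their steps. The step at
    k + s - 1 is the only one where both factors contribute. *)
Lemma path_of_face n r s k (t : 'rV[R]_r) (u : 'rV[R]_s) :
  is_face n r s k -> associahedron t -> associahedron u ->
  path_of (face_op k n t u) = insert k s (path_of t) (path_of u).
Proof.
case/and4P => r1 s1 /eqP rsn kr At Au.
have [U0 U1 _ _ Ue] := lpath_path_of s1 Au.
apply/funext; elim=> [|m IH]; first by rewrite path_of0 /insert path_of0.
rewrite path_ofS {}IH; have [mn|nm] := ltnP m n; last first.
  rewrite addr0 /insert; case_ifs.
  have -> : (m.+1 - s.-1 = (m - s.-1).+1)%N by lia.
  by rewrite path_ofS ifF ?addr0//; lia.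
pose F i := if (i < k)%N then coord t i
            else if (i < k + s.-1)%N then coord u (i - k)
            else if i == (k + s.-1)%N then coord u s.-1 + coord t k
            else coord t (i - s.-1).
have -> : coord (face_op k n t u) m = F m by exact: (coord_row F mn).
rewrite /F /insert; case_ifs.
- by rewrite path_ofS ifT//; lia.
- have -> : m = k by lia.
  by rewrite subnn subSnn (path_ofS u) path_of0 ifT; [ring|lia].
- have -> : (m.+1 - k = (m - k).+1)%N by lia.
  by rewrite (path_ofS u) ifT; [ring|lia].
- have -> : (m.+1 - s.-1 = k.+1)%N by lia.
  have -> : (m - k = s.-1)%N by lia.
  have := path_ofS u s.-1; rewrite prednK ?(ltnW s1)// leqnn Ue//.
  by rewrite (path_ofS t) kr; lra.
- have -> : (m.+1 - s.-1 = (m - s.-1).+1)%N by lia.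
  by rewrite (path_ofS t) ifT//; lia.
Qed.

Lemma path_of_bary n : (1 < n)%N -> path_of (bary n) = bary_path (R := R) n.
Proof.
move=> n1; apply/funext; elim=> [|m IH]; first exact: path_of0.
rewrite path_ofS {}IH; case: ifP => mn; last first.
  by rewrite addr0 /bary_path; case_ifs.
pose F i : R := if i == 0%N then 0 else if i == n.-1 then n%:R / 2 else 1 / 2.
have -> : coord (bary n) m = F m by exact: (coord_row F mn).
rewrite /F /bary_path; case_ifs.
- have -> : m = 0%N by lia.
  lra.
- have -> : n = m.+1 by lia.
  lra.
- by rewrite -(natr1 m.+1); lra.
Qed.

Lemma path_of_cone n (a : R) (t : 'rV[R]_n) : (1 < n)%N ->
  path_of ((1 - a) *: t + a *: bary n) = cone_path n a (path_of t).
Proof.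
move=> n1; apply/funext => m; rewrite /cone_path -path_of_bary// /path_of.
under eq_bigr do rewrite coordD !coordZ.
by rewrite big_split /= -!mulr_sumr; ring.
Qed.

End PathOf.

Section SmoothCfg.
Context {R : realType}.

Lemma smooth_on_linear m n (f : 'rV[R]_m -> 'rV[R]_n) (U : set 'rV[R]_m) :
  open U -> linear f -> smooth_on U f.
Proof.
move=> oU lf k.
pose fL : {linear 'rV[R]_m -> 'rV[R]_n} :=
  HB.pack f (GRing.isLinear.Build _ _ _ _ _ lf).
apply: (Ck_eq oU (f := fun x => \sum_(i < m) x 0 i *: f (delta_mx 0 i))).
  move=> x _; rewrite [in RHS](row_sum_delta x) -[f]/(fL : _ -> _) linear_sum.
  by apply: eq_bigr => i _; rewrite linearZ.
apply: Ck_sum => // i; apply: Ck_scale => //; last exact: Ck_cst.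
exact: (Ck_linear oU (L := coordL i)) (@coord_continuous _ _ _ 0 i)
  (Ck_id oU k).
Qed.

Definition smooth_cfg (V : normedModType R) (U : set V)
    (C : V -> nat -> R * R) :=
  forall i, smooth_on U (fun x => (C x i).1) /\
            smooth_on U (fun x => (C x i).2).

Lemma smooth_cfg_eq (V : normedModType R) (U : set V)
    (C D : V -> nat -> R * R) :
  (forall x, C x = D x) -> smooth_cfg U C -> smooth_cfg U D.
Proof. by move=> /funext ->. Qed.

Lemma smooth_cfg_cst (V : normedModType R) (U : set V) C : open U ->
  smooth_cfg U (fun=> C).
Proof. by move=> oU i; split=> k; exact: Ck_cst. Qed.

Lemma smooth_cfg_plug (V : normedModType R) (U : set V) k s C D : open U ->
  smooth_cfg U C -> smooth_cfg U D ->
  smooth_cfg U (fun x => plug k s (C x) (D x)).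
Proof.
move=> oU sC sD i; rewrite /plug; case: (ltnP i k) => _; first exact: sC.
case: (ltnP i (k + s)) => _; last exact: sC.
have [c1 c2] := sC k; have [d1 d2] := sD (i - k)%N.
by split=> l /=; [apply: CkD_real => //|]; apply: CkM.
Qed.

Lemma smooth_cfg_mix (V : normedModType R) (U : set V) (l : V -> R) C D :
  open U -> smooth_on U l -> smooth_cfg U C -> smooth_cfg U D ->
  smooth_cfg U (fun x => mix (l x) (C x) (D x)).
Proof.
move=> oU sl sC sD i; have [c1 c2] := sC i; have [d1 d2] := sD i.
have s1l : smooth_on U (fun x => 1 - l x).
  move=> k; apply: CkD_real => //; first exact: Ck_cst.
  apply: (Ck_eq oU (f := fun x => (-1) * l x)) => [x _|]; first by rewrite mulN1r.
  by apply: CkM => //; exact: Ck_cst.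
by split=> k /=; apply: CkD_real => //; apply: CkM.
Qed.

Lemma smooth_cfg_comp m n (C : 'rV[R]_n -> nat -> R * R)
    (f : 'rV[R]_m -> 'rV[R]_n) :
  smooth_cfg setT C -> linear f -> smooth_cfg setT (C \o f).
Proof.
move=> sC lf i; have [c1 c2] := sC i.
have sf := smooth_on_linear openT lf.
by split; [exact: smooth_on_comp openT openT _ sf c1
          |exact: smooth_on_comp openT openT _ sf c2].
Qed.

Lemma linear_lsubmx m n : linear (@lsubmx R 1 m n).
Proof. by move=> a x y; apply/matrixP => i j; rewrite !mxE. Qed.

Lemma linear_rsubmx m n : linear (@rsubmx R 1 m n).
Proof. by move=> a x y; apply/matrixP => i j; rewrite !mxE. Qed.

(** On a join, [step] removes [pi_set] from the weight of the barycenter. The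
    rest is made of sums and products of smooth functions. *)
Lemma smooth_cfg_cell n (c : cell n) :
  smooth_cfg setT (fun x => cfg n (path_of (cell_proj (R := R) (c := c) x))).
Proof.
have cellA m (d : cell m) x : associahedron (cell_proj (R := R) (c := d) x).
  exact: cell_set_sub (cell_projP x).
pose cell_cfg m (d : cell m) x := cfg m (path_of (cell_proj (R := R) (c := d) x)).
have face_smooth m r s k (h : is_face m r s k) (a : cell r) (b : cell s) :
    smooth_cfg setT (@cell_cfg r a) -> smooth_cfg setT (@cell_cfg s b) ->
    smooth_cfg setT (@cell_cfg m (face_cell h a b)).
  have /and4P[r1 s1 /eqP rsm kr] := h.
  move=> sa sb; have em : m = (r + s.-1)%N by lia.
  apply: (smooth_cfg_eq (C := fun x => plug k s
      (cfg r (path_of (cell_proj (c := a) (lsubmx x))))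
      (cfg s (path_of (cell_proj (c := b) (rsubmx x)))))).
    move=> x; rewrite /cell_cfg /= path_of_face// [in RHS]em cfg_insert//;
      exact: lpath_path_of.
  apply: smooth_cfg_plug; first exact: openT.
    exact: smooth_cfg_comp sa (@linear_lsubmx _ _).
  exact: smooth_cfg_comp sb (@linear_rsubmx _ _).
elim: c => {n} [|n r s k h a IHa b IHb|n r s k h a IHa b IHb].
- exact: (@smooth_cfg_cst 'rV[R]_0 setT (cfg 2 (path_of (bary 2))) openT).
- exact: face_smooth.
have /and4P[r1 s1 /eqP rsn kr] := h; have en : n = (r + s.-1)%N by lia.
have n1 : (1 < n)%N by lia.
apply: (smooth_cfg_eq (C := fun x => mix (step (rsubmx x 0 0))
   (cfg n (path_of (cell_proj (c := face_cell h a b) (lsubmx x)))) (std_cfg n))).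
  move=> x; rewrite [cell_proj _ in RHS]/= path_of_cone// -step_pi_set.
  have B : bracket n
      (path_of (cell_proj (R := R) (c := face_cell h a b) (lsubmx x))) k s.
    rewrite path_of_face// {1}en; apply: bracket_insert => //;
      exact: lpath_path_of.
  have := pi_set_itv (rsubmx x 0 0); rewrite in_itv => p01.
  by rewrite (cfg_cone (lpath_path_of n1 (cellA _ _ _)) B).
apply: smooth_cfg_mix; first exact: openT.
- apply: (@smooth_on_comp R _ _ _ setT setT _ (fun y : 'rV_1 => step (y 0 0))).
  + exact: openT.
  + exact: openT.
  + by [].
  + exact: smooth_on_linear openT (@linear_rsubmx _ _).
  + move=> l; apply: (@Ck_comp_real R _ _ l setT setT (coordL 0)) => //.
    * exact: openT.
    * exact: openT.
    * exact: (Ck_linear openT (L := coordL 0)) (@coord_continuous _ _ _ 0 0)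
        (Ck_id openT l).
    * exact: smooth_step openT l.
- exact: (smooth_cfg_comp (face_smooth _ _ _ _ h a b IHa IHb)
    (@linear_lsubmx _ _)).
- by apply: smooth_cfg_cst; exact: openT.
Qed.

End SmoothCfg.

Section Final.
Context {R : realType}.

Section Pullback.
Variables (T : Type) (Y : diffSpace R) (g : T -> Y).

#[local] Obligation Tactic := idtac.

Program Definition pullback_diffeology : diffeology R T :=
  {| plot m U p := isplot Y U (g \o p) |}.
Next Obligation. by move=> m U p /plot_open. Qed.
Next Obligation. by move=> m U p q pq; apply: plot_eq => x /pq /= ->. Qed.
Next Obligation. by move=> m U t oU; exact: (plot_cst (diffeo Y) (g t) oU). Qed.
Next Obligation. by move=> m U p oU H; exact: plot_local. Qed.
Next Obligation. by move=> m n U A h p oA sh hAU /(plot_comp oA sh hAU). Qed.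

End Pullback.

(** The pullback along g of the diffeology of Y is admissible, hence coarser
    than the final diffeology. *)
Lemma smooth_final I (X : I -> diffSpace R) T (f : forall i, X i -> T)
    (Y : diffSpace R) (g : T -> Y) :
  (forall i, smooth (fun x => g (f i x))) ->
  @smooth R (DiffSpace (final_diffeology f)) Y g.
Proof.
move=> sg m U p [oU /(_ (pullback_diffeology g))]; apply=> i k A q pq.
exact: sg pq.
Qed.

Lemma smooth_euclid (W : normedModType R) d (f : 'rV[R]_d -> W) :
  smooth_on setT f -> @smooth R (euclid 'rV[R]_d) (euclid W) f.
Proof.
move=> sf m U p [oU sp]; split=> //.
exact: smooth_on_comp oU openT _ sp sf.
Qed.

Lemma smooth_complex_cfg n i :
  @smooth R (complex_space n) (euclid R)
    (fun v => (cfg n (path_of (sval v)) i).1) /\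
  @smooth R (complex_space n) (euclid R)
    (fun v => (cfg n (path_of (sval v)) i).2).
Proof.
split; apply: smooth_final => c.
  apply: (@smooth_final _ _ _ _ (euclid R)
    (fun x => (cfg n (path_of (sval x)) i).1)) => _.
  have [? ?] := smooth_cfg_cell (R := R) c i.
  exact: (@smooth_euclid R (cell_dim c)
    (fun x => (cfg n (path_of (cell_proj x)) i).1)).
apply: (@smooth_final _ _ _ _ (euclid R)
  (fun x => (cfg n (path_of (sval x)) i).2)) => _.
have [? ?] := smooth_cfg_cell (R := R) c i.
  exact: (@smooth_euclid R (cell_dim c)
    (fun x => (cfg n (path_of (cell_proj x)) i).2)).
Qed.

End Final.

(** * Juxtaposition of loops *)

Section Local.
Context {R : realType}.
Implicit Types C D : nat -> R * R.

(** The inverse of the affine map of [aff]. *)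
Definition local_coord (p : R * R) (x : R) : R := (x - p.1) / p.2.

Lemma local_coord_gt0 (p : R * R) x : 0 < p.2 ->
  (0 < local_coord p x) = (p.1 < x).
Proof. by move=> w0; rewrite /local_coord pmulr_lgt0 ?invr_gt0// subr_gt0. Qed.

Lemma local_coord_ge0 (p : R * R) x : 0 < p.2 ->
  (0 <= local_coord p x) = (p.1 <= x).
Proof. by move=> w0; rewrite /local_coord pmulr_lge0 ?invr_gt0// subr_ge0. Qed.

Lemma local_coord_lt1 (p : R * R) x : 0 < p.2 ->
  (local_coord p x < 1) = (x < p.1 + p.2).
Proof. by move=> w0; rewrite /local_coord ltr_pdivrMr// mul1r ltrBlDl. Qed.

Lemma local_coord_le1 (p : R * R) x : 0 < p.2 ->
  (local_coord p x <= 1) = (x <= p.1 + p.2).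
Proof. by move=> w0; rewrite /local_coord ler_pdivrMr// mul1r lerBlDl. Qed.

Lemma local_coord_aff (p q : R * R) x : 0 < p.2 -> 0 < q.2 ->
  local_coord (aff p q) x = local_coord q (local_coord p x).
Proof.
move=> p0 q0; rewrite /local_coord /aff /=; field.
by rewrite !gt_eqF.
Qed.

Lemma local_coord_sep n C x i j : valid n C -> (i < n)%N -> (j < n)%N ->
  0 <= local_coord (C i) x <= 1 -> 0 <= local_coord (C j) x <= 1 -> i = j.
Proof.
move=> [C1 C2] ltin ltjn.
have [_ wi _] := C1 i ltin; have [_ wj _] := C1 j ltjn.
rewrite !local_coord_ge0// !local_coord_le1// => /andP[ai bi] /andP[aj bj].
have [ij|ji|//] := ltngtP i j.
  by have := C2 i j; rewrite ij ltjn => /(_ isT) ?; exfalso; lra.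
by have := C2 j i; rewrite ji ltin => /(_ isT) ?; exfalso; lra.
Qed.

Definition hit n C (x : R) (i : nat) : Prop :=
  (i < n)%N /\ 0 < local_coord (C i) x < 1.

Lemma hit_inj n C x i j : valid n C -> hit n C x i -> hit n C x j -> i = j.
Proof.
move=> vC [ltin /andP[i0 i1]] [ltjn /andP[j0 j1]].
by apply: (local_coord_sep (x := x) vC ltin ltjn); rewrite ?(ltW i0) ?(ltW j0) ltW.
Qed.

Lemma hit_itv n C x i : valid n C -> hit n C x i -> 0 < x < 1.
Proof.
move=> [C1 _] [ltin]; have [a0 w0 b1] := C1 i ltin.
by rewrite local_coord_gt0// local_coord_lt1// => /andP[ax xb]; apply/andP; split; lra.
Qed.

Section Juxt.
Variables (T : Type) (x0 : T).
Implicit Types g : nat -> R -> T.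

(** At most one interval of a valid configuration is hit ([hit_inj]), which
    makes the choice harmless. The default index n is never hit. *)
Definition juxt_fun n C g (x : R) : T :=
  let i := xget n (hit n C x) in
  if `[< hit n C x i >] then g i (local_coord (C i) x) else x0.

Lemma juxt_hit n C g x i : valid n C -> hit n C x i ->
  juxt_fun n C g x = g i (local_coord (C i) x).
Proof.
move=> vC hi; rewrite /juxt_fun.
have hj : hit n C x (xget n (hit n C x)) by apply: xgetPex; exists i.
by rewrite asboolT// (hit_inj vC hi hj).
Qed.

Lemma juxt_nohit n C g x : (forall i, ~ hit n C x i) -> juxt_fun n C g x = x0.
Proof. by move=> nh; rewrite /juxt_fun asboolF. Qed.

Lemma eq_juxt n C g g' x : (forall i, (i < n)%N -> g i = g' i) ->
  juxt_fun n C g x = juxt_fun n C g' x.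
Proof.
by move=> gg'; rewrite /juxt_fun; case: asboolP => // -[ltin _]; rewrite gg'.
Qed.

Lemma juxt_out n C g x : valid n C -> ~~ (0 < x < 1) -> juxt_fun n C g x = x0.
Proof.
by move=> vC xo; apply: juxt_nohit => i /(hit_itv vC); exact/negP.
Qed.

(** The i-th factor has value x0 outside of its interval, so that its formula
    may be used there too, as long as the other factors contribute nothing. Across
    the ends of an interval this gives a single expression. *)
Lemma juxt_only n C g x i : valid n C -> (i < n)%N ->
  (forall y, ~~ (0 < y < 1) -> g i y = x0) ->
  (forall j, hit n C x j -> j != i -> g j (local_coord (C j) x) = x0) ->
  juxt_fun n C g x = g i (local_coord (C i) x).
Proof.
move=> vC ltin gi go; have [[j hj]|nh] := pselect (exists j, hit n C x j).
  rewrite (juxt_hit g vC hj); have [->//|ne] := eqVneq j i.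
  rewrite (go _ hj ne) gi//; apply/negP => hi.
  by move/eqP: ne; apply; exact: hit_inj vC hj (conj ltin hi).
rewrite juxt_nohit ?gi//; last by move=> j hj; apply: nh; exists j.
by apply/negP => hi; apply: nh; exists i.
Qed.

(** By [local_coord_aff], the local coordinate in an interval of D drawn inside
    the k-th interval of C is obtained in two steps, and the first one hits as
    soon as the second does. *)
Lemma juxt_plug r s k C D g x : (0 < s)%N -> (k < r)%N ->
  valid r C -> valid s D ->
  juxt_fun (r + s.-1) (plug k s C D) g x =
  juxt_fun r C (fun i => if (i < k)%N then g i
     else if i == k then juxt_fun s D (fun j => g (k + j)%N)
     else g (i + s.-1)%N) x.
Proof.
move=> s0 kr vC vD; have vP := valid_plug s0 kr vC vD.
have [C1 _] := vC; have [D1 _] := vD; have [_ wk _] := C1 k kr.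
have pL i : (i < k)%N -> plug k s C D i = C i by move=> ik; rewrite /plug ik.
have pM j : (j < s)%N -> plug k s C D (k + j)%N = aff (C k) (D j).
  by move=> js; rewrite /plug ifF ?ifT ?addKn//; lia.
have pR i : (k < i)%N -> plug k s C D (i + s.-1)%N = C i.
  by move=> ki; rewrite /plug !ifF ?addnK//; lia.
have lM j : (j < s)%N ->
    local_coord (aff (C k) (D j)) x = local_coord (D j) (local_coord (C k) x).
  by move=> js; have [_ wj _] := D1 j js; rewrite local_coord_aff.
have [[i [ltir hi]]|nh] := pselect (exists i, hit r C x i); last first.
  rewrite [RHS]juxt_nohit => [|i hi]; last by apply: nh; exists i.
  apply: juxt_nohit => i [ltin]; have [ik|ki] := ltnP i k.
    by rewrite pL// => hi; apply: nh; exists i; split=> //; lia.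
  have [iks|ksi] := ltnP i (k + s).
    rewrite -(subnKC ki) pM ?lM; [|lia..] => hi.
    have hD : hit s D (local_coord (C k) x) (i - k)%N by split=> //; lia.
    by apply: nh; exists k; split=> //; exact: hit_itv vD hD.
  rewrite (_ : i = i - s.-1 + s.-1)%N; last lia.
  rewrite pR; last lia.
  by move=> hi; apply: nh; exists (i - s.-1)%N; split=> //; lia.
rewrite [RHS](juxt_hit _ vC (conj ltir hi)).
have [ik|ki|eik] := ltngtP i k.
- rewrite (@juxt_hit _ _ _ _ i) ?pL//; split; rewrite ?pL//; lia.
- rewrite (@juxt_hit _ _ _ _ (i + s.-1)%N) ?pR//; split; rewrite ?pR//; lia.
rewrite eik in hi ltir *.
have [[j [js hj]]|nj] := pselect (exists j, hit s D (local_coord (C k) x) j).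
  rewrite [RHS](juxt_hit _ vD (conj js hj)).
  by rewrite (@juxt_hit _ _ _ _ (k + j)%N) ?pM ?lM//; split; rewrite ?pM ?lM//; lia.
rewrite [RHS]juxt_nohit => [|j hj]; last by apply: nj; exists j.
apply: juxt_nohit => m [ltm hm].
have [mk|km] := ltnP m k.
  have mr : (m < r)%N by lia.
  have e : m = k by apply: (@hit_inj r C x) => //; split=> //; rewrite -pL.
  by move: mk; rewrite e ltnn.
have [mks|ksm] := ltnP m (k + s).
  apply: nj; exists (m - k)%N; split; first lia.
  rewrite -lM; last lia.
  rewrite -pM; last lia.
  by rewrite subnKC.
have em : m = (m - s.-1 + s.-1)%N by lia.
have e : (m - s.-1)%N = k.
  apply: (@hit_inj r C x) => //; split; first lia.
  by rewrite -pR -?em; last lia.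
lia.
Qed.

End Juxt.

End Local.

Section Loops.
Context {R : realType} {X : diffSpace R} (x0 : X).

Definition loop_val (u : loop_space x0) : R -> X := sval (sval u).

Lemma pi_set_out (y : R) : ~~ (0 < y < 1) -> pi_set y = 0 \/ pi_set y = 1.
Proof.
rewrite negb_and -!leNgt => /orP[y0|y1]; rewrite /pi_set; [left|right].
  by rewrite (min_r (le_trans y0 ler01)) (max_l y0).
by rewrite (min_l y1) (max_r ler01).
Qed.

Lemma loop_val_out u y : ~~ (0 < y < 1) -> loop_val u y = x0.
Proof.
move=> yo; have [pu u0 u1] := svalP u.
have -> : loop_val u y = loop_val u (pi_set y).
  exact: (esym (congr1 (@^~ y) pu)).
by have [->|->] := pi_set_out yo.
Qed.

Lemma plot_loop_val m (A B : set 'rV[R]_m) (u : 'rV[R]_m -> loop_space x0) z :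
  isplot (loop_space x0) A u -> open B -> B `<=` A -> smooth_on B z ->
  isplot X B (fun w => loop_val (u w) (z w)).
Proof.
move=> [oA pu] oB BA sz; apply: (pu m B id z) => //.
by move=> k; exact: Ck_id.
Qed.

Lemma loop_eq (u v : loop_space x0) : loop_val u =1 loop_val v -> u = v.
Proof.
move=> /funext uv; apply: eq_sig_hprop => [*|]; first exact: Prop_irrelevance.
apply: eq_sig_hprop => [*|]; [exact: Prop_irrelevance|exact: uv]. Qed.

Lemma smooth_local_coord (V : normedModType R) (A : set V) (C : V -> R * R) y :
  open A -> smooth_on A (fun w => (C w).1) -> smooth_on A (fun w => (C w).2) ->
  (forall w, A w -> 0 < (C w).2) -> smooth_on A y ->
  smooth_on A (fun w => local_coord (C w) (y w)).
Proof.
move=> oA s1 s2 C0 sy k; apply: CkM => //; last first.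
  by apply: CkV => // x Ax; rewrite gt_eqF// C0.
apply: CkD_real => //.
apply: (Ck_eq oA (f := fun x => (-1) * (C x).1)) => [x _|]; first by rewrite mulN1r.
by apply: CkM => //; exact: Ck_cst.
Qed.

(** The closed intervals are disjoint, so at most one of them contains the
    parameter at a given point. All the others are avoided in a neighborhood,
    where [juxt_only] leaves one factor, or none. *)
Lemma plot_juxt n m (A : set 'rV[R]_m) (C : 'rV[R]_m -> nat -> R * R)
    (u : nat -> 'rV[R]_m -> loop_space x0) y :
  open A -> (forall w, A w -> valid n (C w)) ->
  (forall i, (i < n)%N -> smooth_on A (fun w => (C w i).1) /\
                          smooth_on A (fun w => (C w i).2)) ->
  (forall i, (i < n)%N -> isplot (loop_space x0) A (u i)) -> smooth_on A y ->
  isplot X A (fun w => juxt_fun x0 n (C w) (fun i => loop_val (u i w)) (y w)).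
Proof.
move=> oA vC sC pu sy.
have sZ i : (i < n)%N -> smooth_on A (fun w => local_coord (C w i) (y w)).
  move=> ltin; have [s1 s2] := sC i ltin.
  apply: smooth_local_coord => // w Aw.
  by have [/(_ i ltin)[]] := vC w Aw.
apply: plot_local => // w0 Aw0.
(* The complement of [0, 1] is open: a local coordinate outside of it at w0
   stays outside nearby. *)
pose near_good w := A w /\ forall i : 'I_n,
  ~~ (0 <= local_coord (C w0 i) (y w0) <= 1) ->
  ~~ (0 <= local_coord (C w i) (y w) <= 1).
have near_out : \forall w \near w0, near_good w.
  near=> w; split; first by near: w; exact: open_nbhs_nbhs.
  near: w; apply: filter_forall => i.
  have [_|out] := boolP (0 <= local_coord (C w0 i) (y w0) <= 1).
    by near=> w.
  have cZ : {for w0, continuous (fun w => local_coord (C w i) (y w))}.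
    exact: (sZ i (ltn_ord i) 0) w0 Aw0.
  have nZ : nbhs (local_coord (C w0 i) (y w0)) (~` `[0, 1]).
    apply: open_nbhs_nbhs; split; first exact/closed_openC/itv_closed.
    by rewrite /= in_itv /=; exact/negP.
  near=> w => _; apply/negP.
  have : (~` `[0, 1]) (local_coord (C w i) (y w)) by near: w; exact: cZ nZ.
  by rewrite /= in_itv.
have [B [oB Bw0] BP] : exists2 B, open_nbhs w0 B & B `<=` near_good.
  by have : nbhs w0 near_good := near_out; rewrite nbhsE.
have BA : B `<=` A by move=> w /BP[].
exists B; split=> //.
have [[i [ltin hi]]|nh] :=
  pselect (exists i, (i < n)%N /\ 0 <= local_coord (C w0 i) (y w0) <= 1).
  apply: (plot_eq (p := fun w => loop_val (u i w) (local_coord (C w i) (y w)))).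
    move=> w Bw; apply/esym; have [Aw near] := BP w Bw.
    apply: (juxt_only (g := fun i => loop_val (u i w))) => //; first exact: vC.
      by move=> z; exact: loop_val_out.
    move=> j [ltjn /andP[j0 j1]] ne.
    suff /near : ~~ (0 <= local_coord (C w0 (Ordinal ltjn)) (y w0) <= 1).
      by rewrite /= (ltW j0) (ltW j1).
    apply/negP => hj; move/eqP: ne; apply.
    exact: local_coord_sep (vC _ Aw0) ltjn ltin hj hi.
  apply: (plot_loop_val (pu i ltin) oB BA).
  exact: smooth_on_sub BA (sZ i ltin).
apply: (plot_eq (p := cst x0)); last exact: plot_cst.
move=> w Bw; apply/esym/juxt_nohit => j [ltjn /andP[j0 j1]].
have [Aw near] := BP w Bw.
suff /near : ~~ (0 <= local_coord (C w0 (Ordinal ltjn)) (y w0) <= 1).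
  by rewrite /= (ltW j0) (ltW j1).
by apply/negP => hj; apply: nh; exists j.
Unshelve. all: by end_near. Qed.

End Loops.

(** * The form on the loop space *)

Section JuxtLoop.
Context {R : realType} {X : diffSpace R} (x0 : X).
Local Notation L := (loop_space x0).

Lemma juxt_smooth n C (g : nat -> L) : valid n C ->
  @smooth R (euclid R) X (juxt_fun x0 n C (fun i => loop_val (g i))).
Proof.
move=> vC m U p [oU sp].
apply: (plot_juxt (C := fun=> C) (u := fun i _ => g i)) => //.
- by move=> i _; split=> k; exact: Ck_cst.
- by move=> i _; exact: plot_cst.
Qed.

Definition juxt_path n C (g : nat -> L) (vC : valid n C) :
  fun_space (euclid R) X := exist _ _ (juxt_smooth g vC).

Lemma juxt_path_loop n C (g : nat -> L) (vC : valid n C) :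
  loops x0 (juxt_path g vC).
Proof.
have out y : ~~ (0 < y < 1) -> ev (juxt_path g vC) y = x0.
  exact: juxt_out.
split; [|by apply: out; rewrite ltxx|by apply: out; rewrite ltxx andbF].
apply/funext => y /=; have [/andP[y0 y1]|yo] := boolP (0 < y < 1).
  by rewrite pi_set_id// in_itv /= !ltW.
apply: etrans (esym (out y yo)); apply: out.
by have [->|->] := pi_set_out yo; rewrite ltxx ?andbF.
Qed.

Definition juxt n C (g : nat -> L) (vC : valid n C) : L :=
  exist _ _ (juxt_path_loop g vC).

Lemma smooth_juxt (Y : diffSpace R) n (C : Y -> nat -> R * R)
    (vC : forall v, valid n (C v)) (g : nat -> Y -> L) :
  (forall i, (i < n)%N -> @smooth R Y (euclid R) (fun v => (C v i).1) /\
                          @smooth R Y (euclid R) (fun v => (C v i).2)) ->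
  (forall i, (i < n)%N -> smooth (g i)) ->
  smooth (fun v => juxt (fun i => g i v) (vC v)).
Proof.
move=> sC sg m U p pp; have oU := plot_open pp; split=> // d A a q sa aU [oA sq].
have ppa : isplot Y A (p \o a) by exact: plot_comp oA sa aU pp.
apply: (plot_juxt (C := fun w => C (p (a w))) (u := fun i w => g i (p (a w)))) => //.
- move=> i ltin; have [s1 s2] := sC i ltin.
  by have [_ ?] := s1 _ _ _ ppa; have [_ ?] := s2 _ _ _ ppa.
- by move=> i ltin; exact: sg ltin _ _ _ ppa.
Qed.

Definition pad n (g : 'I_n -> L) (i : nat) : L :=
  oapp g (cst_loop x0) (insub i).

Lemma pad_lt n (g : nat -> L) i : (i < n)%N -> pad (fun j : 'I_n => g j) i = g i.
Proof. by move=> ltin; rewrite /pad insubT. Qed.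

Lemma smooth_pad n i : smooth (fun g : power_space n L => pad g i).
Proof.
rewrite /pad; case: insubP => [j _ _|_] /=; last exact: smooth_cst.
by move=> m U p [_]; exact.
Qed.

Definition loop_form n (p : prod_space (complex_space n) (power_space n L)) : L :=
  juxt (pad p.2) (valid_cfg n (path_of (sval p.1))).

Lemma smooth_loop_form n : smooth (@loop_form n).
Proof.
apply: (smooth_juxt (Y := prod_space (complex_space n) (power_space n L))
          (C := fun p => cfg n (path_of (sval p.1)))
          (fun p => valid_cfg n (path_of (sval p.1)))
          (g := fun i p => pad p.2 i)) => i _.
  have [s1 s2] := @smooth_complex_cfg R n i.
  by split=> m U p [p1 p2]; [exact: s1 p1|exact: s2 p1].
by move=> m U p [p1 p2]; exact: smooth_pad p2.
Qed.

Lemma loop_form_face n r s k (h : is_face n r s k)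
    (rho : complex_space r) (kappa : complex_space s) (g : nat -> L) :
  loop_form (face h rho kappa, fun i : 'I_n => g i) =
  loop_form (rho, fun i : 'I_r =>
    graft k s (loop_form (kappa, fun j : 'I_s => g (k + j)%N)) g i).
Proof.
have /and4P[r1 s1 /eqP rsn kr] := h; have en : n = (r + s.-1)%N by lia.
apply: loop_eq => x.
have pr := lpath_path_of r1 (svalP rho); have ps := lpath_path_of s1 (svalP kappa).
have vr := valid_cfg r (path_of (sval rho)).
have vs := valid_cfg s (path_of (sval kappa)).
rewrite /loop_val /=.
rewrite (path_of_face h (svalP rho) (svalP kappa)).
rewrite (eq_juxt _ _ _ (g' := fun i => loop_val (g i))); last first.
  by move=> i ltin; rewrite pad_lt.
rewrite en cfg_insert// juxt_plug//; last lia.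
apply: eq_juxt => i ltir.
rewrite (pad_lt (graft k s (loop_form (kappa, fun j : 'I_s => g (k + j)%N)) g))//.
rewrite /graft; case: ifP => // _; case: ifP => // _.
apply/funext => y; rewrite /loop_val /=; apply: eq_juxt => j ltjs.
by rewrite (pad_lt (fun j => g (k + j)%N)).
Qed.

(** The parameter of a homotopy ranges over all the reals; [step] keeps the
    interval valid for each of them. *)
Definition widen (i : nat) (t : R) : nat -> R * R :=
  mix (step t) (fun=> std_cfg 2 i) (fun=> (0, 1)).

Lemma valid_widen i t : (i < 2)%N -> valid 1 (widen i t).
Proof.
move=> i2; apply: valid_mix; first exact: step_itv.
  split=> [j _|j l /andP[]]; last lia.
  by have [/(_ i i2)] := @valid_std_cfg R 2.
split=> [j _|j l /andP[]] /=; last lia.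
by rewrite add0r.
Qed.

(** When all factors but the i-th are constant, the product is the i-th factor
    run on the i-th interval, and [widen] ends with the interval [0, 1]. *)
Lemma homotopic_unit i (i2 : (i < 2)%N) (f : L -> power_space 2 L) :
  (forall g, pad (f g) i = g) ->
  (forall g j, (j < 2)%N -> j != i -> pad (f g) j = cst_loop x0) ->
  homotopic (fun g => loop_form (bary2, f g)) id.
Proof.
move=> fi fj.
exists (fun p => juxt (fun=> p.2) (valid_widen p.1 i2)); split.
- apply: (smooth_juxt (Y := prod_space (euclid R) L)
    (C := fun p => widen i p.1) (fun p => valid_widen p.1 i2) (g := fun _ p => p.2)) => [j _|j _ m U p []//].
  have sfst : @smooth R (prod_space (euclid R) L) (euclid R) fst.
    by move=> m U p [].
  have sC : smooth_cfg setT (widen i).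
    apply: smooth_cfg_mix; [exact: openT|by apply: smooth_step; exact: openT| |];
      apply: smooth_cfg_cst; exact: openT.
  have [s1 s2] := sC j.
  split=> m U p [[oU sp] _]; split=> // k.
    exact: (Ck_comp_real (g := fun t => (widen i t j).1) oU openT (fun _ _ => I)
      (sp k) (s1 k)).
  exact: (Ck_comp_real (g := fun t => (widen i t j).2) oU openT (fun _ _ => I)
      (sp k) (s2 k)).
- move=> g; apply: loop_eq => x; rewrite /loop_val /= /widen step_le0// mix0.
  rewrite /cfg cfg_rec_small//.
  have vs := @valid_std_cfg R 2.
  have v1 : valid 1 (fun=> std_cfg 2 i : R * R).
    by have := valid_widen 0 i2; rewrite /widen step_le0// mix0.
  rewrite (juxt_only (i := 0%N) v1)//; first last.
  + by move=> j [+ _]; case: j.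
  + by move=> y; exact: loop_val_out.
  rewrite (juxt_only (i := i) (g := fun j => loop_val (pad (f g) j)) vs) ?fi//.
  + by move=> y; exact: loop_val_out.
  + by move=> j [j2 _] ne; rewrite fj.
- move=> g; apply: loop_eq => x; rewrite /loop_val /= /widen step_ge1// mix1.
  have v1 : valid 1 (fun=> (0, 1) : R * R).
    by have := valid_widen 1 i2; rewrite /widen step_ge1// mix1.
  rewrite (juxt_only (i := 0%N) v1)//; first last.
  + by move=> j [+ _]; case: j.
  + by move=> y; exact: loop_val_out.
  by rewrite /local_coord subr0 divr1.
Qed.

End JuxtLoop.

Theorem corollaryA2 (R : realType) (X : diffSpace R) (x0 : X) :
  h_unital_Ainfty_space (cst_loop x0).
Proof.
exists (@loop_form R X x0); split.
- by split=> [n _|]; [exact: smooth_loop_form|exact: loop_form_face].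
- apply: (homotopic_unit (i := 1%N)) => // g.
    by rewrite /pad insubT.
  by move=> [|[|j]]// _ _; rewrite /pad insubT.
- apply: (homotopic_unit (i := 0%N)) => // g.
    by rewrite /pad insubT.
  by move=> [|[|j]]// _ _; rewrite /pad insubT.
Qed.
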